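(* There exist positive constants $c_1,c_2$ such that for every $n\ge1$ and every Hankel matrix $\Gamma=(\gamma_{j+k})_{0\le k,j\le n-1}$ of size $n\times n$ with complex entries, with standard symbol $\phi=\gamma_0\bar z+\gamma_1\bar z^2+\ldots+\gamma_{2n-2}\bar z^{2n-1}$, one has $$c_1\|\phi\|_{\mu_{2n}^*}\le\|\Gamma\|\le c_2\|\phi\|_{\mu_{2n}^*},$$ where $\mu_{2n}=\frac1{2n}\sum_{\xi^{2n}=1}\delta_\xi$ is the Haar measure on the group $\{\xi\in\mathbb{C}:\xi^{2n}=1\}$ (so $c_1,c_2$ do not depend on $n$).
   Context: $\|\Gamma\|$ is the operator norm of $\Gamma$ on $\mathbb{C}^n$ with the Euclidean norm. For a finite positive Borel measure $\mu$ on the unit circle $\mathbb{T}$ and $b\in L^1(\mu)$, $\|b\|_{\mu^*}=\sup_\Delta\frac1{\mu(\Delta)}\int_\Delta|b-\langle b\rangle_{\Delta,\mu}|\,d\mu$, where $\Delta$ runs over all arcs of $\mathbb{T}$ with $\mu(\Delta)\neq0$ and $\langle b\rangle_{\Delta,\mu}=\frac1{\mu(\Delta)}\int_\Delta b\,d\mu$. *)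

(* Defs.v *)
From HB Require Import structures.
From mathcomp Require Import all_boot all_order all_algebra complex.
From mathcomp Require Import all_classical all_reals all_analysis.

Set Implicit Arguments.
Unset Strict Implicit.
Unset Printing Implicit Defensive.

Import Order.TTheory GRing.Theory Num.Theory.
Import numFieldNormedType.Exports.
Import ComplexField.Normc.

Local Open Scope classical_set_scope.
Local Open Scope ring_scope.
Local Open Scope complex_scope.

Section UnitCircle.
Variable R : realType.

(* The unit circle with the topology induced by the complex plane and the
   associated Borel sigma-algebra. [R[i]^o] is [R[i]] seen as a topological
   space; [normc] is the modulus with values in [R], not in [R[i]]. *)
Definition circle_set : set R[i]^o := [set z | normc z = 1].
Definition circle := set_type circle_set.

Lemma expi_subproof (t : R) : (cos t +i* sin t) \in circle_set.
Proof. by rewrite inE /circle_set /= cos2Dsin2 sqrtr1. Qed.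

(* e^{it} as a point of the circle *)
Definition expi (t : R) : circle := SigSub (expi_subproof t).

HB.instance Definition _ := Topological.on circle.
HB.instance Definition _ := Choice.on circle.
HB.instance Definition _ := isPointed.Build circle (expi 0).
HB.instance Definition _ :=
  Measurable.copy circle (g_sigma_algebraType (@open circle)).

(* An arc is the image of an interval of angles; endpoints may or may not be
   included, and the whole circle is an arc. *)
Definition is_arc (D : set circle) : Prop :=
  exists I : interval R, D = expi @` [set` I].

End UnitCircle.

Section MeanOscillation.
Variables (R : realType) (mu : {finite_measure set (circle R) -> \bar R}).
Implicit Types (b : circle R -> R[i]) (D : set (circle R)).

(* Meaningful for [b] integrable; the integral of a complex function is taken
   componentwise, and [mu D] is a real number since [mu] is finite. *)
Definition average D b : R[i] :=
  ((fine (mu D))^-1)%:C *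
  (Rintegral mu D (fun z => complex.Re (b z)) +i*
   Rintegral mu D (fun z => complex.Im (b z))).

Definition mean_oscillation D b : \bar R :=
  (((fine (mu D))^-1)%:E *
   \int[mu]_(z in D) (normc (b z - average D b))%:E)%E.

Definition bmo_norm b : \bar R :=
  ereal_sup [set mean_oscillation D b | D in [set D | is_arc D /\ mu D != 0%E]].

End MeanOscillation.

Section RootsOfUnity.
Variables (R : realType) (N : nat).

Definition unity_roots : set (circle R) := [set xi | (\val xi : R[i]) ^+ N = 1].

(* For [N = 0] this is the zero measure. *)
Definition haar_unity_roots (A : set (circle R)) : \bar R :=
  ((N%:R^-1)%:E * \sum_(xi \in unity_roots) (\d_xi A : \bar R))%E.

Lemma finite_unity_roots : (0 < N)%N -> finite_set unity_roots.
Proof.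
move=> N0.
have [r Er] := closed_field_poly_normal ('X^N - 1 : {poly R[i]}).
have -> : unity_roots = \val @^-1` [set` r] `&` unity_roots.
  apply/seteqP; split=> [xi xi1|xi []//]; split=> //=.
  have : root ('X^N - 1 : {poly R[i]}) (\val xi).
    by rewrite rootE !hornerE xi1 subrr.
  rewrite Er rootZ ?root_prod_XsubC//.
  by rewrite lead_coef_eq0 -size_poly_eq0 size_XnsubC.
apply: sub_finite_set (@subIsetl _ _ _) _.
apply: finite_preimage; last exact: finite_seq.
by move=> x y _ _; exact: val_inj.
Qed.

Lemma haar_unity_roots_measure :
  exists m : {measure set (circle R) -> \bar R}, haar_unity_roots =1 m.
Proof.
have [N0|N0] := posnP N.
  exists mzero => A; by rewrite /haar_unity_roots N0 invr0 mul0e.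
have r0 : (0 : R) <= N%:R^-1 by rewrite invr_ge0.
pose s : seq (circle R) := finmap.enum_fset (fset_set unity_roots).
exists (mscale (NngNum r0)
  (msum (fun k => \d_(nth (expi 0) s k)) (size s))) => A.
rewrite /haar_unity_roots fsbig_finite/=.
  by rewrite /mscale/= /msum (big_nth (expi 0)) big_mkord.
exact: finite_unity_roots.
Qed.

Let haar0 : haar_unity_roots set0 = 0%E.
Proof. by have [m ->] := haar_unity_roots_measure; rewrite measure0. Qed.

Let haar_ge0 A : (0 <= haar_unity_roots A)%E.
Proof. by have [m ->] := haar_unity_roots_measure. Qed.

Let haar_sigma_additive : semi_sigma_additive haar_unity_roots.
Proof.
have [m /funext ->] := haar_unity_roots_measure.
exact: measure_semi_sigma_additive.
Qed.

HB.instance Definition _ := isMeasure.Build _ _ _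
  haar_unity_roots haar0 haar_ge0 haar_sigma_additive.

Let haar_fin_num : fin_num_fun haar_unity_roots.
Proof.
move=> A _; rewrite /haar_unity_roots; have [->|N0] := posnP N.
  by rewrite invr0 mul0e.
rewrite fsbig_finite/=; last exact: finite_unity_roots.
rewrite fin_numM//.
by rewrite sum_fin_num; apply/allP => _ /mapP[xi _ ->].
Qed.

HB.instance Definition _ :=
  @Measure_isFinite.Build _ _ _ haar_unity_roots haar_fin_num.

End RootsOfUnity.

Section Hankel.
Variable R : realType.

Definition euclidean_norm n (x : 'cV[R[i]]_n) : R :=
  Num.sqrt (\sum_i normc (x i 0) ^+ 2).

Definition operator_norm n (A : 'M[R[i]]_n) : \bar R :=
  ereal_sup [set (euclidean_norm (A *m x))%:E | x in
             [set x : 'cV[R[i]]_n | euclidean_norm x <= 1]].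

(* Only the entries gamma 0, ..., gamma (2 n - 2) of [gamma] are used. *)
Definition hankel_mx n (gamma : nat -> R[i]) : 'M[R[i]]_n :=
  \matrix_(j < n, k < n) gamma (j + k)%N.

Definition standard_symbol n (gamma : nat -> R[i]) (z : circle R) : R[i] :=
  \sum_(0 <= k < (2 * n).-1) gamma k * conjc (\val z) ^+ k.+1.

End Hankel.

(* Main.v *)
Require Import Defs.
From mathcomp Require Import all_boot all_order all_algebra complex polyrcf polyXY.
From mathcomp Require Import all_classical all_reals all_analysis.
From mathcomp Require Import measurable_realfun simple_functions.
From mathcomp Require Import ring lra zify.

(** Let [N = 2n], let [G] be the group of [N]-th roots of unity and [phi] the
    symbol, an arbitrary mean zero function on [G]; the Hankel form is
    [(f, g) |-> int phi z f g dmu] for polynomials [f], [g] of degree [< n].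

    Upper bound. Write [Gamma = Gamma_1 + Gamma_2] where [Gamma_1] has the
    entries [(1 - (j + k + 1) / N) gamma_(j + k)]; reflecting the symbol turns
    [Gamma_2] into a matrix of the same kind. The form of [Gamma_1] is the
    pairing of [z f g] with the Fejer interpolation [psi] of [phi], extended
    harmonically to the disc by the positive kernel
    [sum_l (1 - |l| / N) r^|l| e^(i l t)], which has mass one on [G]. Hence
    [u = T(|phi|^2) - |psi|^2] is a variance, where [T] is the same extension,
    and [Delta u = - |grad psi|^2]. If [0 <= u <= 1/4], then
    [P = (1 - u + u^2) (|z f|^2 + |g|^2) - psi z f g] has a nonnegative
    Laplacian in real part (a variant of Uchiyama's lemma), and comparing its
    mean over the circle with its value at the origin gives
    [Re Gamma_1(f, g) <= |f|^2 + |g|^2]. The kernel decays quadratically, so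
    that [u] is bounded by the square of the [BMO] norm through the [L^2] form
    of the John-Nirenberg inequality.

    Lower bound. The tent function at frequency [n] cuts out of [phi] a piece
    that is pointwise at most [|Gamma|] (test the form on [z |-> sum_k y^k z^k]).
    What remains is an antianalytic and an analytic piece of degree [< n] whose
    Hankel matrices are averages of compressions of [Gamma]. For the
    antianalytic piece [psi], applying the matrix to the reproducing kernel
    [1 / (1 - m conj z)] gives [(psi - psi(m)) / (1 - m conj z)], so by Parseval
    [psi] has a bounded Garsia norm, and this controls mean oscillation. *)

Set Implicit Arguments.
Unset Strict Implicit.
Unset Printing Implicit Defensive.

Import Order.TTheory GRing.Theory Num.Theory.
Import numFieldNormedType.Exports HBNNSimple.
Import ComplexField.Normc.

Local Open Scope classical_set_scope.
Local Open Scope ring_scope.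
Local Open Scope complex_scope.

(** * Oscillation in the mean on intervals of integers *)

Section JohnNirenberg.
Variable R : realFieldType.
Implicit Types (b : nat -> R) (c B : R).

Definition avg b (l r : nat) : R := (\sum_(l <= i < r) b i) / (r - l)%:R.

Lemma sum_sub_sqr b c l r : (l < r)%N ->
  \sum_(l <= i < r) (b i - c) ^+ 2 =
  \sum_(l <= i < r) (b i - avg b l r) ^+ 2 + (r - l)%:R * (avg b l r - c) ^+ 2.
Proof.
move=> lr; set A := avg b l r.
have n0 : (r - l)%:R != 0 :> R by rewrite pnatr_eq0; lia.
have SA : \sum_(l <= i < r) b i = (r - l)%:R * A.
  by rewrite /A /avg mulrC divfK.
have -> : \sum_(l <= i < r) (b i - c) ^+ 2 = \sum_(l <= i < r)
   ((b i - A) ^+ 2 + (2 * (A - c) * b i + (c ^+ 2 - A ^+ 2))).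
  by apply: eq_bigr => i _; ring.
rewrite big_split /=; congr (_ + _).
rewrite big_split /= -mulr_sumr SA sumr_const_nat -mulr_natr; ring.
Qed.

Lemma avg_dist b c l r : (l < r)%N ->
  (r - l)%:R * `|avg b l r - c| <= \sum_(l <= i < r) `|b i - c|.
Proof.
move=> lr.
have n0 : 0 < (r - l)%:R :> R by rewrite ltr0n; lia.
rewrite -[X in X * _]gtr0_norm// -normrM mulrBr /avg mulrC divfK ?gt_eqF//.
rewrite mulr_natl -sumr_const_nat -sumrB.
exact: ler_norm_sum.
Qed.

Variables (N : nat) (b : nat -> R) (B : R).
Hypothesis B0 : 0 < B.
Hypothesis bmo : forall l r, (l < r)%N -> (r - l <= N)%N ->
  \sum_(l <= i < r) `|b i - avg b l r| <= B * (r - l)%:R.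

Let JN m := forall l r, (l < r)%N -> (r - l <= N)%N -> (r - l <= m)%N ->
  \sum_(l <= i < r) (b i - avg b l r) ^+ 2 <= 36 * B ^+ 2 * (r - l)%:R.

(** Calderon-Zygmund argument by bisection. A half on which [|b - c|] still has mean at most [2 B]
    is split further. On any other half the average is within [6 B] of [c], so [JN m] bounds the sum
    of squares by [72 B ^ 2] times the length; as the mean exceeds [2 B] there, this is at most
    [36 B] times the sum of [|b - c|]. *)
Lemma john_nirenberg_good c m l r : JN m -> (l < r)%N -> (r - l <= N)%N ->
  (r - l <= m.+1)%N -> \sum_(l <= i < r) `|b i - c| <= 2 * B * (r - l)%:R ->
  \sum_(l <= i < r) (b i - c) ^+ 2 <= 36 * B * \sum_(l <= i < r) `|b i - c|.
Proof.
move=> JNm; have [k] := ubnP (r - l)%N.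
elim: k l r => [//|k IHk] l r; rewrite ltnS => lk lr lN lm good.
have [r1|r1] := leqP r l.+1.
  have rl : r = l.+1 by lia.
  move: good; rewrite rl !big_nat1 subSnn mulr1 -(real_normK (num_real (b l - c))) => good.
  by rewrite expr2 ler_wpM2r// (le_trans good)// ler_pM2r// ler_nat.
(* Each half of an interval of length at least 2 has at least a third of its length, the worst case
   being 3 = 1 + 2. *)
have part l' r' : (l <= l')%N -> (r' <= r)%N -> (l' < r')%N ->
    (r' - l' < k)%N -> (r' - l' <= m)%N -> (r - l <= 3 * (r' - l'))%N ->
    \sum_(l' <= i < r') (b i - c) ^+ 2 <= 36 * B * \sum_(l' <= i < r') `|b i - c|.
  move=> ll rr lr' k' m' s3.
  have d0 : 0 < (r' - l')%:R :> R by rewrite ltr0n; lia.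
  have [|bad] := leP (\sum_(l' <= i < r') `|b i - c|) (2 * B * (r' - l')%:R).
    by apply: IHk => //; lia.
  have sub : \sum_(l' <= i < r') `|b i - c| <= \sum_(l <= i < r) `|b i - c|.
    rewrite (big_cat_nat (n := l') _ (p := r))//=; last by lia.
    rewrite (big_cat_nat (n := r') _ (p := r))//=; last by lia.
    rewrite addrCA lerDl addr_ge0// sumr_ge0//.
  have A6 : `|avg b l' r' - c| <= 6 * B.
    rewrite -(ler_pM2l d0) (le_trans (avg_dist _ _ _))// (le_trans sub)//.
    rewrite (le_trans good)//.
    have : (r - l)%:R <= 3 * (r' - l')%:R :> R by rewrite -natrM ler_nat.
    by move=> /(ler_wpM2l (ltW B0)); lra.
  rewrite sum_sub_sqr//.
  have /le_trans-> // : \sum_(l' <= i < r') (b i - avg b l' r') ^+ 2 +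
      (r' - l')%:R * (avg b l' r' - c) ^+ 2 <= 72 * B ^+ 2 * (r' - l')%:R.
    have h1 : (avg b l' r' - c) ^+ 2 <= (6 * B) ^+ 2.
      by rewrite -(real_normK (num_real (_ - _))) ler_pXn2r ?nnegrE// mulr_ge0// ltW.
    have h2 := JNm _ _ lr' (ltac:(lia)) m'.
    have h3 : (r' - l')%:R * (avg b l' r' - c) ^+ 2 <= (r' - l')%:R * (6 * B) ^+ 2.
      by rewrite ler_pM2l.
    by lra.
  have := ltW bad; rewrite -(ler_pM2l (_ : 0 < 36 * B)) ?mulr_gt0//.
  by apply: le_trans; lra.
pose h := (l + (r - l)./2)%N.
have := odd_double_half (r - l); rewrite -addnn => hh.
rewrite (big_cat_nat (n := h) _ (p := r))//=; try (rewrite /h; lia).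
rewrite [in leRHS](big_cat_nat (n := h) _ (p := r))//=; try (rewrite /h; lia).
rewrite mulrDr lerD//; apply: part; rewrite /h; lia.
Qed.

Lemma john_nirenberg l r : (l < r)%N -> (r - l <= N)%N ->
  \sum_(l <= i < r) (b i - avg b l r) ^+ 2 <= 36 * B ^+ 2 * (r - l)%:R.
Proof.
move=> lr lN; suff: JN (r - l)%N by apply.
elim: (r - l)%N => [|m IHm] {lr lN}l {}r lr lN lm; first lia.
have d0 : 0 < (r - l)%:R :> R by rewrite ltr0n; lia.
have o := bmo lr lN.
apply: le_trans (john_nirenberg_good IHm lr lN lm _) _.
  by rewrite (le_trans o)// ler_pM2r//; move: B0; lra.
rewrite (_ : 36 * B ^+ 2 * _ = 36 * B * (B * (r - l)%:R)); last by ring.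
by rewrite ler_pM2l ?mulr_gt0.
Qed.

End JohnNirenberg.

(** * Second moments against quadratically decaying weights *)

Lemma centered_length a L : (L <= a)%N -> ((a + L) - (a - L) = 2 * L)%N.
Proof. lia. Qed.

Lemma centered_lt a L : (0 < L)%N -> (a - L < a + L)%N.
Proof. lia. Qed.

Lemma centered_left a L L' i : (a - L <= i < a - L')%N -> ~~ (a - L' <= i < a + L')%N.
Proof. lia. Qed.

Lemma centered_right a L L' i : (a + L' <= i < a + L)%N -> ~~ (a - L' <= i < a + L')%N.
Proof. lia. Qed.

Section Decay.
Variables (R : realFieldType) (n : nat) (b : nat -> R) (B : R).
Hypothesis B0 : 0 < B.
Hypothesis bmo : forall l r, (l < r)%N -> (r - l <= 2 * n)%N ->
  \sum_(l <= i < r) `|b i - avg b l r| <= B * (r - l)%:R.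
Variables (a M : nat) (q : nat -> R) (C : R).
Hypotheses (na : (n <= a)%N) (M0 : (0 < M)%N) (Mn : (M <= n)%N) (C0 : 0 < C).
Hypothesis q_near : forall i, q i <= C / M%:R.
Hypothesis q_far : forall L i, (M <= L)%N -> (a - n <= i < a + n)%N ->
  ~~ (a - L <= i < a + L)%N -> q i <= C * M%:R / L%:R ^+ 2.

Let A L := avg b (a - L) (a + L).

(** Between the radii [2 ^ k M] and [2 ^ (k + 1) M] the weight is at most [C / (4 ^ k M)], and
    doubling the window moves the average by at most [2 B]; with John-Nirenberg this shell costs
    [4 C B ^ 2 (36 + 4 (k + 1) ^ 2) / 2 ^ k]. The subtracted fraction is exactly the tail of this
    series, so the induction telescopes; [138 = 18 + 120], where 18 comes from the innermost
    window. *)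
Lemma decay_step k L : (M <= L <= n)%N -> (L <= 2 ^ k * M)%N ->
  `|A L - A M| <= 2 * B * k%:R /\
  \sum_(a - L <= i < a + L) q i * (b i - A M) ^+ 2 <=
  4 * C * B ^+ 2 * (138 - (8 * k%:R ^+ 2 + 32 * k%:R + 120) / 2 ^+ k).
Proof.
have MR0 : 0 < M%:R :> R by rewrite ltr0n.
have sumJN c L' : (0 < L')%N -> (L' <= n)%N ->
    \sum_(a - L' <= i < a + L') (b i - c) ^+ 2 <=
    (2 * L')%:R * (36 * B ^+ 2 + (A L' - c) ^+ 2).
  move=> L0 Ln; rewrite sum_sub_sqr; last exact: centered_lt.
  have e := centered_length (leq_trans Ln na).
  have := john_nirenberg B0 bmo (l := (a - L')%N) (r := (a + L')%N).
  rewrite e leq_mul2l Ln orbT centered_lt// => /(_ isT isT); rewrite -/(A L').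
  by move: (2 * L')%:R (A L') => x y; lra.
elim: k L => [|k IHk] L /andP[ML Ln] Lk.
  have {ML Ln Lk}-> : L = M by apply/eqP; rewrite eqn_leq ML -[M]mul1n Lk.
  rewrite subrr normr0 mulr0; split=> //.
  apply: (@le_trans _ _ (\sum_(a - M <= i < a + M) C / M%:R * (b i - A M) ^+ 2)).
    by apply: ler_sum => i _; rewrite ler_wpM2r ?sqr_ge0.
  rewrite -mulr_sumr; have := sumJN (A M) M M0 Mn.
  rewrite subrr expr0n addr0 => /(ler_wpM2l (ltW (divr_gt0 C0 MR0))) /le_trans->//.
  rewrite natrM le_eqVlt; apply/orP; left; apply/eqP.
  by rewrite expr0 (_ : 0%:R = 0)//; field; rewrite gt_eqF.
have p0 : 0 < 2 ^+ k :> R by rewrite exprn_gt0.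
have pk : (2 ^+ k.+1 : R)^-1 = (2 ^+ k)^-1 / 2 by rewrite exprS invfM mulrC.
have pi0 : 0 < (2 ^+ k : R)^-1 by rewrite invr_gt0.
have k0 : 0 <= k%:R :> R by [].
have [Lk'|Lk'] := leqP L (2 ^ k * M)%N.
  have [|h1 h2] := IHk L _ Lk'; first by rewrite ML Ln.
  split; first by rewrite (le_trans h1)// ler_pM2l ?mulr_gt0// ler_nat.
  apply: le_trans h2 _; rewrite ler_pM2l ?mulr_gt0// ?exprn_gt0//.
  rewrite lerD2l lerN2 pk -(natr1 k); move: pi0 k0.
  move: (_^-1) k%:R => x y x0 y0; rewrite -subr_ge0.
  rewrite (_ : _ - _ = x * (4 * y ^+ 2 + 8 * y + 40)); last by field.
  by apply: mulr_ge0; [exact: ltW | rewrite !addr_ge0 ?mulr_ge0 ?exprn_ge0].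
set L' := (2 ^ k * M)%N in Lk'.
have L'0 : (0 < L')%N by rewrite muln_gt0 expn_gt0.
have L2 : (L <= 2 * L')%N by move: Lk; rewrite expnS -mulnA.
have ML' : (M <= L')%N by rewrite leq_pmull// expn_gt0.
have LL := ltnW Lk'; have L'n := leq_trans LL Ln; have L0 := leq_trans L'0 LL.
have L'R : 0 < L'%:R :> R by rewrite ltr0n.
have [|h1 h2] := IHk L' _ (leqnn _); first by rewrite ML'.
have L'E : L'%:R = 2 ^+ k * M%:R :> R by rewrite natrM natrX.
clearbody L'; clear Lk Lk' IHk.
have split_sum (F : nat -> R) : \sum_(a - L <= i < a + L) F i =
    \sum_(a - L <= i < a - L') F i + \sum_(a - L' <= i < a + L') F i +
    \sum_(a + L' <= i < a + L) F i.
  rewrite (big_cat_nat (n := (a - L')%N))//= ?leq_sub2l ?(leq_trans (leq_subr _ _)) ?leq_addr//.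
  rewrite (big_cat_nat (n := (a + L')%N) (p := (a + L)%N))//= ?addrA//.
    exact/ltnW/centered_lt.
  by rewrite leq_add2l.
have d1 : `|A L - A L'| <= 2 * B.
  have e := centered_length (leq_trans L'n na).
  have e' := centered_length (leq_trans Ln na).
  have lr' := centered_lt a L'0.
  have lr := centered_lt a L0.
  have /le_trans := avg_dist b (A L) lr'; rewrite e -/(A L').
  have o : \sum_(a - L' <= i < a + L') `|b i - A L| <= B * (2 * L)%:R.
    have := bmo lr; rewrite e' leq_mul2l Ln orbT => /(_ isT); rewrite -/(A L).
    apply: le_trans; rewrite split_sum addrAC lerDr addr_ge0// sumr_ge0//.
  move=> /(_ _ o); rewrite distrC => o'.
  have LR : (2 * L)%:R <= 2 * (2 * L')%:R :> R by rewrite -natrM ler_nat leq_mul2l L2.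
  have D0 : 0 < (2 * L')%:R :> R by rewrite ltr0n muln_gt0.
  rewrite -(ler_pM2l D0) (le_trans o')//.
  by have := ler_wpM2l (ltW B0) LR; lra.
have d2 : `|A L - A M| <= 2 * B * k.+1%:R.
  rewrite -(subrKA (A L')) (le_trans (ler_normD _ _))//.
  by rewrite -(natr1 k) mulrDr mulr1 addrC lerD.
split=> //.
have far (l r : nat) : (a - n <= l)%N -> (r <= a + n)%N ->
    (forall i, (l <= i < r)%N -> ~~ (a - L' <= i < a + L')%N) ->
    \sum_(l <= i < r) q i * (b i - A M) ^+ 2 <=
    C * M%:R / L'%:R ^+ 2 * \sum_(l <= i < r) (b i - A M) ^+ 2.
  move=> al ra out; rewrite mulr_sumr ler_sum_nat// => i lir.
  rewrite ler_wpM2r ?sqr_ge0// q_far ?out//; case/andP: lir => li ir.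
  by rewrite (leq_trans al li) (leq_trans ir ra).
have f1 := far (a - L)%N (a - L')%N (leq_sub2l _ Ln)
  (leq_trans (leq_subr _ _) (leq_addr _ _)) (@centered_left _ _ _).
have f2 := far (a + L')%N (a + L)%N (leq_trans (leq_subr _ _) (leq_addr _ _))
  (leq_add (leqnn a) Ln) (@centered_right _ _ _).
have f3 : 0 <= \sum_(a - L' <= i < a + L') (b i - A M) ^+ 2.
  by rewrite sumr_ge0// => i _; rewrite sqr_ge0.
have f4 := sumJN (A M) L L0 Ln.
have f5 : (A L - A M) ^+ 2 <= (2 * B * k.+1%:R) ^+ 2.
  rewrite -(real_normK (num_real (_ - _))) ler_pXn2r ?nnegrE//.
  by rewrite !mulr_ge0// ltW.
rewrite split_sum in f4; rewrite split_sum.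
set Q := C * M%:R / L'%:R ^+ 2 in f1 f2.
have Q0 : 0 < Q by rewrite divr_gt0 ?mulr_gt0 ?exprn_gt0.
have f6 : \sum_(a - L <= i < a - L') (b i - A M) ^+ 2 +
          \sum_(a + L' <= i < a + L) (b i - A M) ^+ 2 <=
          4 * L'%:R * (36 * B ^+ 2 + (2 * B * k.+1%:R) ^+ 2).
  have g1 : (2 * L)%:R <= 4 * L'%:R :> R.
    by rewrite -natrM ler_nat -[4%N]/(2 * 2)%N -mulnA leq_mul2l L2.
  have g2 : (2 * L)%:R * (36 * B ^+ 2 + (A L - A M) ^+ 2) <=
     4 * L'%:R * (36 * B ^+ 2 + (2 * B * k.+1%:R) ^+ 2).
    apply: ler_pM => //; last by rewrite lerD2l.
    by rewrite addr_ge0 ?sqr_ge0// mulr_ge0 ?sqr_ge0.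
  by lra.
have := ler_wpM2l (ltW Q0) f6.
have -> : Q * (4 * L'%:R * (36 * B ^+ 2 + (2 * B * k.+1%:R) ^+ 2)) =
    4 * C * B ^+ 2 * ((2 ^+ k)^-1 * (36 + 4 * (k.+1%:R) ^+ 2)).
  rewrite /Q L'E; field.
  by rewrite !gt_eqF.
rewrite mulrDr pk -(natr1 k) => f7.
apply: le_trans (lerD (lerD f1 h2) f2) _.
rewrite addrAC (le_trans (lerD f7 (lexx _)))// -mulrDr.
by rewrite ler_pM2l ?mulr_gt0 ?exprn_gt0//; lra.
Qed.

Lemma sum_decay :
  \sum_(a - n <= i < a + n) q i * (b i - A M) ^+ 2 <= 552 * C * B ^+ 2.
Proof.
have Mnn : (M <= n <= n)%N by rewrite Mn leqnn.
(* A crude number of doublings suffices, since the bound of [decay_step] stays below 138 for every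
   [k]. *)
have n2 : (n <= 2 ^ n * M)%N.
  by apply: leq_trans (leq_pmulr _ M0); apply: ltnW; apply: ltn_expl.
have [_ /le_trans-> //] := decay_step Mnn n2.
have -> : 552 * C * B ^+ 2 = 4 * C * B ^+ 2 * 138 by ring.
rewrite ler_pM2l ?mulr_gt0 ?exprn_gt0// gerBl divr_ge0 ?exprn_ge0//.
Qed.

End Decay.

(** * Complex numbers and roots of unity *)

Section SquaredModulus.
Variable R : rcfType.
Implicit Types (x y z : R[i]) (a : R).

(** A real-valued polynomial in the two components, so that estimates become real polynomial
    inequalities. *)
Definition nsq z : R := complex.Re z ^+ 2 + complex.Im z ^+ 2.

Lemma nsq_ge0 z : 0 <= nsq z.
Proof. by rewrite addr_ge0 ?sqr_ge0. Qed.

Lemma nsqM x y : nsq (x * y) = nsq x * nsq y.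
Proof. by case: x y => [a b] [c d]; rewrite /nsq /=; ring. Qed.

Lemma nsqJ z : nsq (conjc z) = nsq z.
Proof. by case: z => a b; rewrite /nsq /= sqrrN. Qed.

Lemma nsqN z : nsq (- z) = nsq z.
Proof. by case: z => a b; rewrite /nsq /= !sqrrN. Qed.

Lemma nsq0 : nsq 0 = 0.
Proof. by rewrite /nsq /= !expr0n /= addr0. Qed.

Lemma nsq1 : nsq 1 = 1.
Proof. by rewrite /nsq /= expr0n expr1n addr0. Qed.

Lemma nsqX z k : nsq (z ^+ k) = nsq z ^+ k.
Proof. by elim: k => [|k IHk]; rewrite ?nsq1// !exprS nsqM IHk. Qed.

Lemma nsq_real a : nsq a%:C = a ^+ 2.
Proof. by rewrite /nsq /= expr0n addr0. Qed.

Lemma nsq_eq0 z : (nsq z == 0) = (z == 0).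
Proof.
case: z => a b; rewrite /nsq eq_complex /= paddr_eq0 ?sqr_ge0//.
by rewrite !sqrf_eq0.
Qed.

Lemma mulcJ z : z * conjc z = (nsq z)%:C.
Proof.
by case: z => a b; apply/eqP; rewrite eq_complex /nsq /=; apply/andP; split; apply/eqP; ring.
Qed.

Lemma conjcM x y : conjc (x * y) = conjc x * conjc y.
Proof. exact: (rmorphM (@conjc R)). Qed.

Lemma conjcD x y : conjc (x + y) = conjc x + conjc y.
Proof. exact: (raddfD (@conjc R)). Qed.

Lemma conjcB x y : conjc (x - y) = conjc x - conjc y.
Proof. exact: (raddfB (@conjc R)). Qed.

Lemma conjcX x k : conjc (x ^+ k) = conjc x ^+ k.
Proof. exact: (rmorphXn (@conjc R)). Qed.

Lemma conjc_sum I r (P : pred I) (F : I -> R[i]) :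
  conjc (\sum_(i <- r | P i) F i) = \sum_(i <- r | P i) conjc (F i).
Proof. exact: (raddf_sum (@conjc R)). Qed.

Lemma rcM a b : (a * b)%:C = a%:C * b%:C :> R[i].
Proof. exact: (rmorphM (real_complex R)). Qed.

Lemma rcD a b : (a + b)%:C = a%:C + b%:C :> R[i].
Proof. exact: (raddfD (real_complex R)). Qed.

Lemma rcB a b : (a - b)%:C = a%:C - b%:C :> R[i].
Proof. exact: (raddfB (real_complex R)). Qed.

Lemma rc_sum I r (P : pred I) (F : I -> R) :
  (\sum_(i <- r | P i) F i)%:C = \sum_(i <- r | P i) (F i)%:C :> R[i].
Proof. exact: (raddf_sum (real_complex R)). Qed.

Lemma invc_nsq1 z : nsq z = 1 -> z^-1 = conjc z.
Proof.
move=> z1; have z0 : z != 0 by rewrite -nsq_eq0 z1 oner_eq0.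
by apply: (mulfI z0); rewrite mulcJ z1 divff.
Qed.

Lemma ReD x y : complex.Re (x + y) = complex.Re x + complex.Re y.
Proof. by case: x y => [a b] [c d]. Qed.

Lemma ReN x : complex.Re (- x) = - complex.Re x.
Proof. by case: x. Qed.

Lemma ReB x y : complex.Re (x - y) = complex.Re x - complex.Re y.
Proof. by rewrite ReD ReN. Qed.

Lemma ImD x y : complex.Im (x + y) = complex.Im x + complex.Im y.
Proof. by case: x y => [a b] [c d]. Qed.

Lemma ImN x : complex.Im (- x) = - complex.Im x.
Proof. by case: x. Qed.

Lemma ReZ a x : complex.Re (a%:C * x) = a * complex.Re x.
Proof. by case: x => b c /=; rewrite mul0r subr0. Qed.

Lemma ImZ a x : complex.Im (a%:C * x) = a * complex.Im x.
Proof. by case: x => b c /=; rewrite mul0r addr0. Qed.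

Lemma Re_sum I r (P : pred I) (F : I -> R[i]) :
  complex.Re (\sum_(i <- r | P i) F i) = \sum_(i <- r | P i) complex.Re (F i).
Proof. exact: (big_morph _ ReD). Qed.

Lemma Im_sum I r (P : pred I) (F : I -> R[i]) :
  complex.Im (\sum_(i <- r | P i) F i) = \sum_(i <- r | P i) complex.Im (F i).
Proof. exact: (big_morph _ ImD). Qed.

Lemma ReMn x k : complex.Re (x *+ k) = complex.Re x *+ k.
Proof. by elim: k => // k IHk; rewrite !mulrS ReD IHk. Qed.

Lemma addcJ2 z : z + conjc z = (2 * complex.Re z)%:C.
Proof.
by case: z => a b; apply/eqP; rewrite eq_complex /=; apply/andP; split; apply/eqP; ring.
Qed.

Lemma Re_sqr_le z : complex.Re z ^+ 2 <= nsq z.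
Proof. by rewrite lerDl sqr_ge0. Qed.

Lemma nsqD_le x y : nsq (x + y) <= 2 * (nsq x + nsq y).
Proof.
case: x y => [a b] [c d]; rewrite /nsq /=.
have := sqr_ge0 (a - c); have := sqr_ge0 (b - d); lra.
Qed.

(** Cauchy-Schwarz: for real sequences it is the nonnegativity of the variance, and the two
    components are added. *)
Lemma nsq_sum_le n (F : nat -> R[i]) :
  nsq (\sum_(0 <= i < n) F i) <= n%:R * \sum_(0 <= i < n) nsq (F i).
Proof.
have key (f : nat -> R) :
    (\sum_(0 <= i < n) f i) ^+ 2 <= n%:R * \sum_(0 <= i < n) f i ^+ 2.
  have [->|n0] := posnP n; first by rewrite !big_geq// mul0r expr0n.
  set A := (\sum_(0 <= i < n) f i) / n%:R.
  have nR : n%:R != 0 :> R by rewrite pnatr_eq0 -lt0n.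
  have SA : \sum_(0 <= i < n) f i = n%:R * A by rewrite /A mulrC divfK.
  have : 0 <= \sum_(0 <= i < n) (f i - A) ^+ 2.
    by apply: sumr_ge0 => i _; rewrite sqr_ge0.
  have -> : \sum_(0 <= i < n) (f i - A) ^+ 2 =
      \sum_(0 <= i < n) f i ^+ 2 - n%:R * A ^+ 2.
    transitivity (\sum_(0 <= i < n) (f i ^+ 2 + (A ^+ 2 - 2 * A * f i))).
      by apply: eq_bigr => i _; ring.
    have SA2 : \sum_(0 <= i < n) 2 * A * f i = 2 * A * (n%:R * A).
      by rewrite -mulr_sumr SA.
    by rewrite big_split sumrB SA2 sumr_const_nat subn0 -[_ *+ n]mulr_natl /=; ring.
  rewrite subr_ge0 SA (_ : (n%:R * A) ^+ 2 = n%:R * (n%:R * A ^+ 2)); last by ring.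
  by rewrite ler_pM2l ?ltr0n.
by rewrite /nsq Re_sum Im_sum big_split mulrDr lerD.
Qed.

End SquaredModulus.

Section RootOfUnity.
Variable R : realType.

Definition expc (t : R) : R[i] := cos t +i* sin t.

Lemma expcD s t : expc (s + t) = expc s * expc t.
Proof. by rewrite /expc; simpc; rewrite cosD sinD [sin s * _ + _]addrC. Qed.

Lemma expc0 : expc 0 = 1.
Proof. by rewrite /expc cos0 sin0. Qed.

Lemma expcMn t k : expc (t *+ k) = expc t ^+ k.
Proof. by elim: k => [|k IHk]; rewrite ?expc0// mulrS expcD IHk exprS. Qed.

Lemma nsq_expc t : nsq (expc t) = 1.
Proof. exact: cos2Dsin2. Qed.

Lemma expc2pi : expc (pi *+ 2) = 1.
Proof. by rewrite /expc cos2pi sin2pi. Qed.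

(** If [cos t = 1], the double angle formula forces [sin (t / 2) = 0], although [t / 2] lies
    strictly between 0 and [pi]. *)
Lemma expc_neq1 t : 0 < t -> t < pi *+ 2 -> expc t != 1.
Proof.
move=> t0 t2; apply/negP; rewrite eq_complex /= => /andP[/eqP c1 _].
have /sin_gt0_pi : 0 < t / 2 < pi.
  by rewrite divr_gt0//= ltr_pdivrMr// mulr_natr.
have := cos_mulr2n (t / 2); have -> : (t / 2) *+ 2 = t by rewrite -mulr_natr divfK// pnatr_eq0.
rewrite c1 => e; have : sin (t / 2) ^+ 2 = 0 by rewrite sin2cos2; lra.
by move/eqP; rewrite sqrf_eq0 => /eqP ->; rewrite ltxx.
Qed.

Definition rootc N : R[i] := expc (pi *+ 2 / N%:R).

Lemma rootcX N k : rootc N ^+ k = expc (pi *+ 2 / N%:R *+ k).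
Proof. by rewrite expcMn. Qed.

Lemma nsq_rootc N : nsq (rootc N) = 1.
Proof. exact: nsq_expc. Qed.

Lemma rootc_prim N : (0 < N)%N -> N.-primitive_root (rootc N).
Proof.
move=> N0; have NR : 0 < N%:R :> R by rewrite ltr0n.
rewrite /primitive_root_of_unity N0 /=; apply/forallP => -[k kN] /=.
rewrite unity_rootE rootcX -[_ *+ k.+1]mulr_natr mulrAC.
move: kN; rewrite leq_eqVlt => /predU1P[<-|kN].
  by rewrite mulfK ?pnatr_eq0// expc2pi !eqxx.
rewrite (ltn_eqF kN) eqbF_neg expc_neq1//.
  by rewrite divr_gt0// mulr_gt0 ?ltr0n// pmulrn_lgt0// pi_gt0.
by rewrite ltr_pdivrMr// ltr_pM2l ?ltr_nat// pmulrn_lgt0// pi_gt0.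
Qed.

End RootOfUnity.

Section Orthogonality.
Variable R : rcfType.

Lemma sum_prim_root (N j : nat) (e : R[i]) : N.-primitive_root e ->
  \sum_(0 <= x < N) (e ^+ j) ^+ x = if (N %| j)%N then N%:R else 0.
Proof.
move=> pe; rewrite big_mkord; case: ifPn => [Nj|Nj].
  rewrite -(prim_expr_mod pe j) (eqP Nj).
  by rewrite expr0 (eq_bigr (fun=> 1)) ?sumr_const ?card_ord// => i _; rewrite expr1n.
have ej : e ^+ j - 1 != 0 by rewrite subr_eq0 -(prim_order_dvd pe).
apply: (mulfI ej); rewrite mulr0 -subrX1 -exprM mulnC exprM.
by rewrite (prim_expr_order pe) expr1n subrr.
Qed.

Lemma orthogonality (N j k : nat) (e : R[i]) : nsq e = 1 ->
  N.-primitive_root e -> (j < N)%N -> (k < N)%N ->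
  \sum_(0 <= x < N) (e ^+ x) ^+ j * conjc ((e ^+ x) ^+ k) = if j == k then N%:R else 0.
Proof.
move=> e1 pe jN kN.
have eJ x : conjc (e ^+ x) = (e ^+ x)^-1 by rewrite invc_nsq1 // nsqX e1 expr1n.
wlog kj : j k jN kN / (k <= j)%N.
  move=> H; have [|jk] := leqP k j; first exact: H.
  have := H k j kN jN (ltnW jk); rewrite eq_sym => /(congr1 (@conjc R)).
  rewrite rmorph_sum (fun_if (@conjc R)) conjc0 conjc_nat => <-.
  by apply: eq_bigr => x _; rewrite rmorphM /= conjcK mulrC.
rewrite (eq_bigr (fun x => (e ^+ (j - k)) ^+ x)); last first.
  move=> x _; rewrite -!exprM eJ mulrC mulnBl exprB ?leq_mul2r ?kj ?orbT//.
    by rewrite mulrC [(x * j)%N]mulnC [(x * k)%N]mulnC.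
  by rewrite unitfE -nsq_eq0 e1 oner_eq0.
rewrite sum_prim_root//; congr (if _ then _ else _).
apply/idP/eqP => [/dvdnP[[|m]]|->]; last by rewrite subnn dvdn0.
  by lia.
by rewrite mulSn; lia.
Qed.

End Orthogonality.

(** * Bivariate polynomials and the mean value inequality *)

Section BivariatePolynomials.
Variable R : realType.
Notation C := R[i].
Implicit Types (p q : {poly {poly C}}) (f g : {poly C}) (z : C).

(** A polynomial function of [z] and [conjc z] is stored with [z] as the outer variable and
    [w = conjc z] as the inner one. Then [deriv] and [dw] are the Wirtinger derivatives, and their
    composite is a quarter of the Laplacian. *)
Definition ev z p : C := p.[z%:P].[conjc z].

Lemma evD z p q : ev z (p + q) = ev z p + ev z q.
Proof. by rewrite /ev !hornerD. Qed.

Lemma evN z p : ev z (- p) = - ev z p.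
Proof. by rewrite /ev !hornerN. Qed.

Lemma evB z p q : ev z (p - q) = ev z p - ev z q.
Proof. by rewrite evD evN. Qed.

Lemma evM z p q : ev z (p * q) = ev z p * ev z q.
Proof. by rewrite /ev !hornerM. Qed.

Lemma ev0 z : ev z 0 = 0.
Proof. by rewrite /ev !horner0. Qed.

Lemma ev1 z : ev z 1 = 1.
Proof. by rewrite /ev !hornerC. Qed.

Lemma ev_sum z I r (P : pred I) (F : I -> {poly {poly C}}) :
  ev z (\sum_(i <- r | P i) F i) = \sum_(i <- r | P i) ev z (F i).
Proof. by rewrite (big_morph (ev z) (evD z) (ev0 z)). Qed.

Lemma evz z f : ev z f^:P = f.[z].
Proof. by rewrite /ev horner_map hornerC. Qed.

Lemma evw z f : ev z f%:P = f.[conjc z].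
Proof. by rewrite /ev hornerC. Qed.

Definition dw p := swapXY (swapXY p)^`().

Lemma dwD p q : dw (p + q) = dw p + dw q.
Proof. by rewrite /dw rmorphD derivD rmorphD. Qed.

Lemma dw0 : dw 0 = 0.
Proof. by rewrite /dw rmorph0 deriv0 rmorph0. Qed.

Lemma dwN p : dw (- p) = - dw p.
Proof. by apply: (addIr (dw p)); rewrite -dwD !addNr dw0. Qed.

Lemma dwM p q : dw (p * q) = dw p * q + p * dw q.
Proof. by rewrite /dw rmorphM derivM rmorphD !rmorphM /= !swapXYK. Qed.

Lemma dw_sum I r (P : pred I) (F : I -> {poly {poly C}}) :
  dw (\sum_(i <- r | P i) F i) = \sum_(i <- r | P i) dw (F i).
Proof. by rewrite (big_morph dw dwD dw0). Qed.

Lemma dwz f : dw f^:P = 0.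
Proof. by rewrite /dw swapXY_map_polyC derivC rmorph0. Qed.

Lemma dww f : dw f%:P = f^`()%:P.
Proof. by rewrite /dw swapXY_polyC deriv_map swapXY_map_polyC. Qed.

(** [(diag p).[r ^ 2]] is the real part of the mean of [p] over the circle of radius [r]: only the
    monomials [z ^ a w ^ a] survive. *)
Definition diag p : {poly R} := \poly_(a < size p) complex.Re p`_a`_a.

Lemma coef_diag p a : (diag p)`_a = complex.Re p`_a`_a.
Proof.
rewrite coef_poly; case: ltnP => // pa.
by rewrite (nth_default 0 pa) coef0.
Qed.

Lemma diagD p q : diag (p + q) = diag p + diag q.
Proof. by apply/polyP => a; rewrite coefD !coef_diag !coefD ReD. Qed.

Lemma diagN p : diag (- p) = - diag p.
Proof. by apply/polyP => a; rewrite coefN !coef_diag !coefN ReN. Qed.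

Lemma diagB p q : diag (p - q) = diag p - diag q.
Proof. by rewrite diagD diagN. Qed.

(** In the variable [s = r ^ 2] the radial form of the quarter Laplacian is [(s h')']. *)
Lemma diag_laplacian p : diag ((dw p)^`()) = ('X * (diag p)^`())^`().
Proof.
apply/polyP => a; rewrite coef_diag !coef_deriv coefXM /= !coef_deriv coef_diag.
rewrite coefMn /dw coef_swapXY coef_deriv coefMn coef_swapXY.
by rewrite !ReMn.
Qed.

Lemma ev_expand M p z : (size p <= M)%N -> (sizeY p <= M)%N ->
  ev z p = \sum_(0 <= a < M) \sum_(0 <= b < M) p`_a`_b * (z ^+ a * conjc z ^+ b).
Proof.
move=> sX sY; rewrite /ev (horner_coef_wide _ sX) horner_sum big_mkord.
apply: eq_bigr => a _; rewrite hornerM horner_exp hornerC.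
rewrite (@horner_coef_wide _ M) ?(leq_trans (max_size_coefXY _ _))//.
rewrite mulr_suml big_mkord; apply: eq_bigr => b _.
by rewrite -mulrA [z ^+ a * _]mulrC.
Qed.

(** Averaging over the [M]-th roots of unity is exact once [M] exceeds both degrees, so a finite sum
    replaces the integral over the circle. *)
Lemma diag_average p : exists2 M, (0 < M)%N & forall r : R,
  M%:R * (diag p).[r ^+ 2] =
  \sum_(0 <= x < M) complex.Re (ev (r%:C * rootc R M ^+ x) p).
Proof.
pose M := (maxn (size p) (sizeY p)).+1; exists M => // r.
have sX : (size p <= M)%N by rewrite leqW// leq_maxl.
have sY : (sizeY p <= M)%N by rewrite leqW// leq_maxr.
rewrite -Re_sum.
under eq_bigr => x _ do rewrite (ev_expand _ sX sY).
rewrite exchange_big /=.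
transitivity (complex.Re (\sum_(0 <= a < M) p`_a`_a * ((r ^+ 2) ^+ a)%:C * M%:R)).
  rewrite Re_sum (@horner_coef_wide _ M); last by rewrite (leq_trans (size_poly _ _)).
  rewrite mulr_sumr big_mkord; apply: eq_bigr => a _.
  have -> : p`_a`_a * ((r ^+ 2) ^+ a)%:C * M%:R = ((r ^+ 2) ^+ a * M%:R)%:C * p`_a`_a.
    by rewrite rmorphM /= rmorph_nat; ring.
  by rewrite ReZ coef_diag; ring.
congr complex.Re; apply: eq_big_nat => a /andP[_ aM].
rewrite exchange_big /= (bigD1_seq a) ?mem_index_iota ?iota_uniq//=.
have orth b : (b < M)%N ->
    \sum_(0 <= x < M) p`_a`_b *
      ((r%:C * rootc R M ^+ x) ^+ a * conjc (r%:C * rootc R M ^+ x) ^+ b) =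
    p`_a`_b * (r ^+ (a + b))%:C * (if a == b then M%:R else 0).
  move=> bM; rewrite -(orthogonality (nsq_rootc R M) (rootc_prim R (ltn0Sn _)) aM bM).
  rewrite mulr_sumr; apply: eq_bigr => x _.
  set w := rootc R M ^+ x.
  have -> : conjc (r%:C * w) = r%:C * conjc w by rewrite rmorphM; congr (_ * _); exact: conjc_real.
  have -> : conjc (w ^+ b) = conjc w ^+ b by rewrite rmorphXn.
  have -> : (r ^+ (a + b))%:C = r%:C ^+ a * r%:C ^+ b by rewrite rmorphXn exprD.
  by rewrite !exprMn; ring.
rewrite (orth _ aM) eqxx -exprM mul2n addnn big1_seq ?addr0// => b /andP[ba].
by rewrite mem_index_iota => /andP[_ bM]; rewrite (orth _ bM) eq_sym (negPf ba) mulr0.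
Qed.

Lemma diag_ge0 p (r : R) : 0 <= r -> r <= 1 ->
  (forall z, nsq z <= 1 -> 0 <= complex.Re (ev z p)) -> 0 <= (diag p).[r ^+ 2].
Proof.
move=> r0 r1 p0; have [M M0 /(_ r) e] := diag_average p.
rewrite -(pmulr_rge0 _ (_ : 0 < M%:R)) ?ltr0n// e sumr_ge0// => x _.
by apply: p0; rewrite nsqM nsq_real nsqX nsq_rootc expr1n mulr1 expr_le1.
Qed.

Lemma poly_le_of_deriv_ge0 (h : {poly R}) (a b : R) : a <= b ->
  (forall s, a < s < b -> 0 <= h^`().[s]) -> h.[a] <= h.[b].
Proof.
rewrite le_eqVlt => /predU1P[->//|ab] h0.
have [c ci e] := poly_mvt h ab.
rewrite -subr_ge0 e; apply: mulr_ge0; last by rewrite subr_ge0 ltW.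
by apply: h0; move: ci; rewrite in_itv.
Qed.

(** With [h = diag p], the polynomial [s h'] vanishes at 0 and has a nonnegative derivative on
    [[0, 1]]; hence [h'] is nonnegative and [h] increases from the centre to the circle. *)
Lemma mean_value_le p :
  (forall z, nsq z <= 1 -> 0 <= complex.Re (ev z (dw p)^`())) ->
  (diag p).[0] <= (diag p).[1].
Proof.
move=> sub; set h := diag p.
have d0 s : 0 <= s -> s <= 1 -> 0 <= (('X * h^`())^`()).[s].
  move=> s0 s1; rewrite -diag_laplacian -(sqr_sqrtr s0) diag_ge0 ?sqrtr_ge0//.
  by rewrite -sqrtr1 ler_sqrt.
apply: poly_le_of_deriv_ge0 => // s /andP[s0 s1].
have := @poly_le_of_deriv_ge0 ('X * h^`()) 0 s (ltW s0).
rewrite !hornerM !hornerX mul0r pmulr_rge0//; apply=> t /andP[t0 ts].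
by rewrite d0// ltW// (lt_trans ts).
Qed.

End BivariatePolynomials.

(** * Laplacian of a weighted squared modulus *)

Section Derivations.
Variables (A B : comNzRingType) (e : B -> A) (d d' : B -> B).
Hypotheses (eD : {morph e : x y / x + y}) (eM : {morph e : x y / x * y}).
Hypotheses (e1 : e 1 = 1).
Hypotheses (dD : {morph d : x y / x + y}) (d'D : {morph d' : x y / x + y}).
Hypotheses (dM : forall x y, d (x * y) = d x * y + x * d y).
Hypotheses (d'M : forall x y, d' (x * y) = d' x * y + x * d' y).

(** Stated for abstract derivations so that [ring] meets only atoms. In the application [d] and [d']
    differentiate in [z] and [conjc z], [G] is analytic, [H] antianalytic, and [e] evaluates at a
    point. *)
Lemma derivation_weighted_product u G H : d' G = 0 -> d H = 0 ->
  e (d (d' ((1 - u + u * u) * (G * H)))) =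
  (2%:R * (e (d' u) * e (d u)) + (2%:R * e u - 1) * e (d (d' u))) * (e G * e H) +
  (2%:R * e u - 1) * e (d' u) * (e (d G) * e H) +
  ((2%:R * e u - 1) * e (d u) * (e G * e (d' H)) +
   (1 - e u + e u ^+ 2) * (e (d G) * e (d' H))) +
   (1 - e u + e u ^+ 2) * (e G * e (d (d' H))) .
Proof.
have z0 (K : zmodType) (f : B -> K) : {morph f : x y / x + y} -> f 0 = 0.
  by move=> fD; apply: (addrI (f 0)); rewrite -fD !addr0.
have zN (K : zmodType) (f : B -> K) : {morph f : x y / x + y} -> {morph f : x / - x}.
  by move=> fD x; apply: (addrI (f x)); rewrite -fD !subrr z0.
have d1 : d 1 = 0.
  by apply: (addrI (d 1)); rewrite addr0 -[in RHS](mulr1 1) dM mulr1 mul1r.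
have d'1 : d' 1 = 0.
  by apply: (addrI (d' 1)); rewrite addr0 -[in RHS](mulr1 1) d'M mulr1 mul1r.
move=> d'G dH.
rewrite !(d'M, d'D, zN _ _ d'D, d'1, d'G) !(dM, dD, zN _ _ dD, d1, z0 _ _ dD, dH).
rewrite !(eM, eD, zN _ _ eD, e1, z0 _ _ eD).
ring.
Qed.

End Derivations.

Section WeightedLaplacian.
Variable R : realType.
Notation C := R[i].
Implicit Types (f g : {poly C}) (z : C).

(** Here [t], [a] and [- k] stand for [u], its derivative and its quarter Laplacian. The quadratic
    term of [1 - u + u ^ 2] yields [2 |a g| ^ 2], which completes the square with the cross terms;
    the bounds on [t] leave at least half of [k |g| ^ 2] and of [|g'| ^ 2]. *)
Lemma laplacian_weight_ge (t k : R) (a g g' : C) : 0 <= t <= 1/4 -> 0 <= k ->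
  2^-1 * (k * nsq g) + 2^-1 * nsq g' <= complex.Re
  ((2%:R * (conjc a * a) + (2 * t - 1)%:C * - k%:C) * (g * conjc g) +
   (2 * t - 1)%:C * conjc a * (g' * conjc g) +
   ((2 * t - 1)%:C * a * (g * conjc g') + (1 - t + t ^+ 2)%:C * (g' * conjc g'))).
Proof.
move=> /andP[t0 t1] k0.
have -> : complex.Re
  ((2%:R * (conjc a * a) + (2 * t - 1)%:C * - k%:C) * (g * conjc g) +
   (2 * t - 1)%:C * conjc a * (g' * conjc g) +
   ((2 * t - 1)%:C * a * (g * conjc g') + (1 - t + t ^+ 2)%:C * (g' * conjc g'))) =
  (1 - 2 * t) * (k * nsq g) + 2 * nsq (conjc (a * g) + (t - 2^-1)%:C * conjc g') +
   (2^-1 + t - t ^+ 2) * nsq g'.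
  by case: a g g' => [a1 a2] [g1 g2] [h1 h2]; rewrite /nsq /=; field.
have h1 : 0 <= (2^-1 - 2 * t) * (k * nsq g).
  by apply: mulr_ge0; [lra | rewrite mulr_ge0 ?nsq_ge0].
have h2 : 0 <= (t - t ^+ 2) * nsq g'.
  by apply: mulr_ge0; [nra | rewrite nsq_ge0].
have := nsq_ge0 (conjc (a * g) + (t - 2^-1)%:C * conjc g').
lra.
Qed.

Lemma weightC (t : R) : (1 - t + t ^+ 2)%:C = 1 - t%:C + t%:C * t%:C.
Proof. by rewrite -rcM -expr2 -(rcB 1 t) -rcD. Qed.

Lemma Re_mul_le (a b : C) : 2 * complex.Re (a * b) <= nsq a + nsq b.
Proof.
case: a b => [a1 a2] [b1 b2]; rewrite /nsq /=.
have := sqr_ge0 (a1 - b1); have := sqr_ge0 (a2 + b2); lra.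
Qed.

Definition cj f : {poly C} := map_poly conjc f.

Lemma evc z (c : C) : ev z c%:P%:P = c.
Proof. by rewrite evw hornerC. Qed.

Lemma ev_cj z f : ev z (cj f)%:P = conjc f.[z].
Proof. by rewrite evw /cj horner_map. Qed.

Lemma laplacian_product (u : {poly {poly C}}) (f : {poly C}) z :
  ev z (dw ((1 - u + u * u) * (f^:P * (cj f)%:P)))^`() =
  (2%:R * (ev z (dw u) * ev z u^`()) + (2%:R * ev z u - 1) * ev z (dw u)^`()) *
    (f.[z] * conjc f.[z]) +
  (2%:R * ev z u - 1) * ev z (dw u) * (f^`().[z] * conjc f.[z]) +
  ((2%:R * ev z u - 1) * ev z u^`() * (f.[z] * conjc f^`().[z]) +
   (1 - ev z u + ev z u ^+ 2) * (f^`().[z] * conjc f^`().[z])).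
Proof.
rewrite (derivation_weighted_product (evD z) (evM z) (ev1 z) (d := deriv) (d' := @dw R)
  (@derivD _) (@dwD R) (@derivM _) (@dwM R)) ?dwz ?derivC//.
rewrite dww derivC ev0 mulr0 mulr0 addr0 deriv_map !evz ev_cj.
by rewrite /cj deriv_map ev_cj.
Qed.

End WeightedLaplacian.

(** * Harmonic extension and the variant of Uchiyama's lemma *)

Section HarmonicExtension.
Variables (R : realType) (N : nat) (phi : nat -> R[i]) (k : nat -> {poly R[i]}).
Notation C := R[i].
Implicit Types (f g : {poly C}) (z : C).

Definition kern z x : R := 2 * complex.Re (k x).[z].

Definition harm (c : nat -> C) : {poly {poly C}} :=
  \sum_(0 <= x < N) (c x)%:P%:P * ((k x)^:P + (cj (k x))%:P).

Lemma ev_harm c z : ev z (harm c) = \sum_(0 <= x < N) c x * (kern z x)%:C.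
Proof.
rewrite ev_sum; apply: eq_bigr => x _.
by rewrite evM evD evz ev_cj addcJ2 evc.
Qed.

Lemma dz_harm c z : ev z (harm c)^`() = \sum_(0 <= x < N) c x * (k x)^`().[z].
Proof.
rewrite raddf_sum /= ev_sum; apply: eq_bigr => x _.
rewrite derivM derivC derivD derivC deriv_map addr0 evD evM ev0 mul0r add0r.
by rewrite evM evz evc.
Qed.

Lemma dw_harm c : dw (harm c) = \sum_(0 <= x < N) (c x)%:P%:P * ((cj (k x))^`())%:P.
Proof.
rewrite dw_sum; apply: eq_bigr => x _.
by rewrite dwM dwD dwz !dww derivC mul0r !add0r.
Qed.

Lemma ev_dw_harm c z : ev z (dw (harm c)) = \sum_(0 <= x < N) c x * conjc (k x)^`().[z].
Proof.
rewrite dw_harm ev_sum; apply: eq_bigr => x _.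
by rewrite evM evc /cj deriv_map ev_cj.
Qed.

Lemma ev_harmJ c z : ev z (harm (conjc \o c)) = conjc (ev z (harm c)).
Proof.
rewrite !ev_harm conjc_sum; apply: eq_bigr => x _.
by rewrite conjcM conjc_real.
Qed.

Lemma ev_dw_harmJ c z : ev z (dw (harm (conjc \o c))) = conjc (ev z (harm c)^`()).
Proof.
rewrite ev_dw_harm dz_harm conjc_sum; apply: eq_bigr => x _.
by rewrite conjcM.
Qed.

Lemma dz_harmJ c z : ev z (harm (conjc \o c))^`() = conjc (ev z (dw (harm c))).
Proof.
rewrite ev_dw_harm dz_harm conjc_sum; apply: eq_bigr => x _.
by rewrite conjcM conjcK.
Qed.

Lemma dzdw_harm c : (dw (harm c))^`() = 0.
Proof.
rewrite dw_harm raddf_sum big1//= => x _.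
by rewrite -polyCM derivC.
Qed.

Let psi := harm phi.
Let psis := harm (conjc \o phi).
Let v := harm (fun x => (nsq (phi x))%:C).
Let u := v - psi * psis.

(** The value of [u] at [z]; it is a variance of [phi] when the kernel is nonnegative of mass
    one. *)
Definition variance z : R := \sum_(0 <= x < N) nsq (phi x) * kern z x -
  nsq (\sum_(0 <= x < N) phi x * (kern z x)%:C).

Let ev_u z : ev z u = (variance z)%:C.
Proof.
rewrite evB evM ev_harmJ mulcJ !ev_harm /variance rcB rc_sum.
by congr (_ - _); apply: eq_bigr => x _; rewrite rcM.
Qed.

Let v_real : harm (conjc \o (fun x => (nsq (phi x))%:C)) = v.
Proof.
by rewrite /harm; apply: eq_bigr => x _; rewrite /comp [conjc _]conjc_real.
Qed.

Let ev_dwu z : ev z (dw u) = conjc (ev z u^`()).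
Proof.
have : ev z (dw v) = conjc (ev z v^`()) by rewrite -{1}v_real ev_dw_harmJ.
have : ev z (dw psi) = conjc (ev z psis^`()) by rewrite dz_harmJ conjcK.
have : ev z (dw psis) = conjc (ev z psi^`()) by rewrite ev_dw_harmJ.
have : ev z psi = conjc (ev z psis) by rewrite ev_harmJ conjcK.
have : ev z psis = conjc (ev z psi) by rewrite ev_harmJ.
rewrite /u; move: psi psis v => p q r E1 E2 E3 E4 E5.
rewrite dwD dwN dwM derivB derivM !evB !evD !evM conjcB conjcD !conjcM.
by rewrite -E1 -E2 -E3 -E4 -E5; ring.
Qed.

(** Since [v], [psi] and [psis] are harmonic, only the two cross terms of the product [psi * psis]
    survive, and each is a squared modulus. *)
Let ev_laplacian_u z : ev z (dw u)^`() =
  - (nsq (ev z (dw psi)) + nsq (ev z psi^`()))%:C.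
Proof.
have E1 : ev z psis^`() = conjc (ev z (dw psi)) by rewrite dz_harmJ.
have E2 : ev z (dw psis) = conjc (ev z psi^`()) by rewrite ev_dw_harmJ.
rewrite rcD -!mulcJ -E1 -E2.
have := dzdw_harm phi; have := dzdw_harm (conjc \o phi).
have := dzdw_harm (fun x => (nsq (phi x))%:C).
rewrite /u -/psi -/psis -/v.
move: psi psis v => p q r F1 F2 F3; rewrite dwD dwN dwM derivD derivN derivD !derivM.
by rewrite F1 F2 F3 mul0r mulr0 addr0 !add0r evN evD !evM.
Qed.

Hypothesis var_le : forall z, nsq z <= 1 -> 0 <= variance z <= 1/4.

Let sqp f : {poly {poly C}} := f^:P * (cj f)%:P.
Let W := 1 - u + u * u.

Let ev_sqp f z : ev z (sqp f) = (nsq f.[z])%:C.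
Proof. by rewrite evM evz ev_cj mulcJ. Qed.

Let ev_W z : ev z W = (1 - variance z + variance z ^+ 2)%:C.
Proof.
by rewrite /W evD evB evM ev1 ev_u weightC.
Qed.

(** Of the gradient of [psi] only the [w]-derivative is kept: it is the one that occurs in the
    Laplacian of [psi F] for analytic [F]. *)
Let laplacian_sqp f z : nsq z <= 1 ->
  2^-1 * (nsq (ev z (dw psi)) * nsq f.[z]) + 2^-1 * nsq f^`().[z] <=
  complex.Re (ev z (dw (W * sqp f))^`()).
Proof.
move=> z1; rewrite laplacian_product ev_dwu ev_u ev_laplacian_u.
set a := ev z u^`(); set k1 := nsq (ev z (dw psi)); set k2 := nsq (ev z psi^`()); set t := variance z.
have k0 : 0 <= k1 + k2 by rewrite addr_ge0 ?nsq_ge0.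
have := laplacian_weight_ge a f.[z] f^`().[z] (var_le z1) k0; rewrite -/t.
have -> : (2 * t - 1)%:C = 2%:R * t%:C - 1 :> C by rewrite rcB rcM (rmorph_nat (real_complex R)).
rewrite weightC -expr2.
apply: le_trans; rewrite lerD2r ler_pM2l ?invr_gt0// ler_wpM2r ?nsq_ge0//.
by rewrite lerDl nsq_ge0.
Qed.

Let laplacian_psi F z : ev z (dw (psi * F^:P))^`() = ev z (dw psi) * F^`().[z].
Proof.
have := dzdw_harm phi; rewrite -/psi; move: psi => p E.
by rewrite dwM dwz mulr0 addr0 derivM E mul0r add0r evM deriv_map evz.
Qed.

Let diag1 (p : {poly {poly C}}) M : (size p <= M)%N -> (diag p).[1] = \sum_(0 <= a < M) complex.Re p`_a`_a.
Proof.
move=> pM; rewrite (@horner_coef_wide _ M); last by rewrite (leq_trans (size_poly _ _)).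
by rewrite big_mkord; apply: eq_bigr => a _; rewrite coef_diag expr1n mulr1.
Qed.

Let coef_zw f h a : (f^:P * h%:P)`_a`_a = f`_a * h`_a.
Proof. by rewrite coefMC coef_map coefCM. Qed.

Let size_zw f h : (size (f^:P * h%:P : {poly {poly C}})%R <= size f)%N.
Proof. by rewrite mulrC mul_polyC (leq_trans (size_scale_leq _ _))// size_map_polyC. Qed.

Let diag1_z (G : {poly C}) : (diag G^:P).[1] = complex.Re G.[0].
Proof.
rewrite (_ : diag G^:P = (complex.Re G.[0])%:P) ?hornerC//.
apply/polyP => a; rewrite coef_diag coef_map !coefC horner_coef0.
by case: eqP => [->|].
Qed.

(** The analytic part of [psi] times [F] vanishes at the origin and has mean zero; the antianalytic
    part is paired with the coefficients of [F]. *)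
Let diag1_psi (F : {poly C}) : F.[0] = 0 -> (diag (psi * F^:P)).[1] =
  complex.Re (\sum_(0 <= x < N) phi x * (\sum_(0 <= a < size F) F`_a * conjc (k x)`_a)).
Proof.
move=> F0; rewrite /psi /harm mulr_suml Re_sum.
have D0 : (diag (0 : {poly {poly C}})).[1] = 0.
  by rewrite (@diag1 0 0%N) ?big_geq// size_poly0.
rewrite (big_morph (fun p : {poly {poly C}} => (diag p).[1]) (_ : {morph _ : p q / p + q >-> p + q}) D0).
  apply: eq_bigr => x _.
  rewrite -mulrA mulrDl mulrDr.
  have -> : (phi x)%:P%:P * ((k x)^:P * F^:P) = ((phi x)%:P * (k x * F))^:P.
    by rewrite !rmorphM /= map_polyC.
  have -> : (phi x)%:P%:P * ((cj (k x))%:P * F^:P) = F^:P * ((phi x)%:P * cj (k x))%:P.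
    by rewrite mulrA -polyCM mulrC.
  rewrite diagD hornerD diag1_z !hornerM F0 !mulr0 add0r (diag1 (size_zw _ _)).
  rewrite -Re_sum mulr_sumr; congr complex.Re; apply: eq_bigr => a _.
  by rewrite coef_zw coefCM coef_map mulrCA.
by move=> p q /=; rewrite diagD hornerD.
Qed.

(** Here [f] already contains the factor [z] of the overview. At the origin [psi f g] vanishes and
    [P] is nonnegative; on the circle [1 - u + u ^ 2 <= 1], so the mean of [P] is at most the two
    sums of squares minus the pairing. *)
Lemma hankel_form_le f g : f.[0] = 0 ->
  complex.Re (\sum_(0 <= x < N) phi x *
    (\sum_(0 <= a < size (f * g)) (f * g)`_a * conjc (k x)`_a)) <=
  \sum_(0 <= a < size f) nsq f`_a + \sum_(0 <= a < size g) nsq g`_a.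
Proof.
move=> f0; pose P := W * sqp f + W * sqp g - psi * (f * g)^:P.
have := @mean_value_le R P.
(* The [w]-derivative of [psi] times [(f g)'] is a sum of two products. The inequality
   [2 Re (a b) <= |a| ^ 2 + |b| ^ 2] bounds them by the four terms that [laplacian_sqp] provides for
   [f] and [g]. *)
have arith (x y x' y' r1 r2 r3 r4 : R) : 2^-1 * x + 2^-1 * x' <= r1 ->
    2^-1 * y + 2^-1 * y' <= r2 -> 2 * r3 <= y + x' -> 2 * r4 <= x + y' ->
    0 <= r1 + r2 - (r3 + r4) by lra.
have subh z : nsq z <= 1 -> 0 <= complex.Re (ev z (dw P)^`()).
  move=> z1; rewrite /P dwD dwN dwD derivB derivD evB evD laplacian_psi ReB ReD.
  have -> : ev z (dw psi) * (f * g)^`().[z] =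
      ev z (dw psi) * g.[z] * f^`().[z] + ev z (dw psi) * f.[z] * g^`().[z].
    by rewrite derivM hornerD !hornerM; ring.
  have h1 := Re_mul_le (ev z (dw psi) * g.[z]) f^`().[z].
  have h2 := Re_mul_le (ev z (dw psi) * f.[z]) g^`().[z].
  rewrite (nsqM _ g.[z]) in h1; rewrite (nsqM _ f.[z]) in h2.
  rewrite ReD; exact: arith (laplacian_sqp f z1) (laplacian_sqp g z1) h1 h2.
move=> /(_ subh); rewrite /P !diagD diagN !hornerD !hornerN.
have diag0 (p : {poly {poly C}}) : (diag p).[0] = complex.Re (ev 0 p).
  by rewrite horner_coef0 coef_diag /ev conjc0 !horner_coef0.
have nsq01 : nsq (0 : C) <= 1 by rewrite nsq0.
have W0 : 0 <= 1 - variance 0 + variance 0 ^+ 2.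
  by have /andP[] := var_le nsq01; have := sqr_ge0 (variance 0); lra.
have Wsq0 h : 0 <= (diag (W * sqp h)).[0].
  rewrite diag0 evM ev_W ev_sqp -rcM /=.
  by rewrite mulr_ge0 ?nsq_ge0.
have psi0 : (diag (psi * (f * g)^:P)).[0] = 0.
  by rewrite diag0 evM evz hornerM f0 mul0r mulr0.
have Wsq1 h : (diag (W * sqp h)).[1] <= (diag (sqp h)).[1].
  rewrite -subr_ge0 -hornerN -hornerD -diagB -(expr1n _ 2%N) diag_ge0// => z z1.
  rewrite evB (evM z W) ev_W ev_sqp -rcM -rcB /= -[X in X - _]mul1r -mulrBl.
  rewrite mulr_ge0 ?nsq_ge0//.
  have /andP[] := var_le z1; nra.
have sq1 h : (diag (sqp h)).[1] = \sum_(0 <= a < size h) nsq h`_a.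
  rewrite (diag1 (size_zw _ _)); apply: eq_bigr => a _.
  by rewrite coef_zw coef_map mulcJ.
have fg0 : (f * g).[0] = 0 by rewrite hornerM f0 mul0r.
move: (Wsq0 f) (Wsq0 g) (Wsq1 f) (Wsq1 g); rewrite psi0 (diag1_psi fg0) !sq1; lra.
Qed.

End HarmonicExtension.

(** * The Fejer-Poisson kernel *)

Section ConvexCosineSums.
Variables (R : rcfType) (rho : nat -> R).
Hypothesis rho0 : rho 0 = 1.
Hypothesis rho_rec : forall l, rho l.+2 = 2 * rho 1 * rho l.+1 - rho l.
Hypothesis rho_le : forall l, `|rho l| <= 1.

Let diff2 (d : nat -> R) l := d l - 2 * d l.+1 + d l.+2.

(** By the recurrence, multiplying [rho] by [2 - 2 rho 1] is minus a second difference, which is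
    then moved onto [d]. *)
Lemma summation_by_parts (d : nat -> R) m :
  (2 - 2 * rho 1) * \sum_(0 <= l < m) d l.+1 * rho l.+1 =
  - \sum_(0 <= l < m) diff2 d l * rho l.+1 +
  (d 0 * rho 1 - d 1 * rho 0 - d m * rho m.+1 + d m.+1 * rho m).
Proof.
elim: m => [|m IHm]; first by rewrite !big_geq//; ring.
by rewrite !big_nat_recr//= mulrDr IHm rho_rec /diff2; ring.
Qed.

Lemma sum_diff2 (d : nat -> R) m :
  \sum_(0 <= l < m) diff2 d l = (d 0 - d 1) - (d m - d m.+1).
Proof.
elim: m => [|m IHm]; first by rewrite big_geq//; ring.
by rewrite big_nat_recr//= IHm /diff2; ring.
Qed.

(** The second differences of [d] and the boundary term [d m] are nonnegative and add up to
    [1 - d 1], so weighting them by [rho] gives at most [1 - d 1] in absolute value. *)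
Lemma convex_cosine_sum (d : nat -> R) m : d 0 = 1 -> 0 <= d m -> d m.+1 = 0 ->
  (forall l, (l < m)%N -> 0 <= diff2 d l) ->
  0 <= (2 - 2 * rho 1) * (1 + 2 * \sum_(0 <= l < m) d l.+1 * rho l.+1) <=
  4 * (1 - d 1).
Proof.
move=> d0 dm dm1 dd.
have -> : (2 - 2 * rho 1) * (1 + 2 * \sum_(0 <= l < m) d l.+1 * rho l.+1) =
    2 * (1 - d 1 - (\sum_(0 <= l < m) diff2 d l * rho l.+1 + d m * rho m.+1)).
  by rewrite mulrDr mulr1 mulrCA summation_by_parts d0 dm1 rho0; ring.
have : `|\sum_(0 <= l < m) diff2 d l * rho l.+1 + d m * rho m.+1| <= 1 - d 1.
  apply: le_trans (ler_normD _ _) _.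
  have -> : 1 - d 1 = \sum_(0 <= l < m) diff2 d l + d m.
    by rewrite sum_diff2 d0 dm1; ring.
  apply: lerD; last by rewrite normrM (ger0_norm dm) ler_piMr.
  apply: le_trans (ler_norm_sum _ _ _) _; apply: ler_sum_nat => l /andP[_ lm].
  by rewrite normrM (ger0_norm (dd _ lm)) ler_piMr// dd.
by rewrite ler_norml => /andP[]; lra.
Qed.

End ConvexCosineSums.

Section FejerPoisson.
Variables (R : rcfType) (m : nat) (r : R) (tau : R[i]).
Hypotheses (r0 : 0 <= r) (r1 : r <= 1) (tau1 : nsq tau = 1).
Let N := m.+1.

Definition fp_coef (l : nat) : R := (1 - l%:R / N%:R) * r ^+ l.

Definition fp_kernel : R :=
  1 + 2 * complex.Re (\sum_(0 <= l < m) (fp_coef l.+1)%:C * tau ^+ l.+1).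

(** The width of the kernel, comparable to the larger of [1 / N] and [1 - r]. *)
Definition fp_eps : R := 1 - (1 - N%:R^-1) * r.

Let N0 : 0 < N%:R :> R.
Proof. by rewrite ltr0n. Qed.

Lemma fp_eps_gt0 : 0 < fp_eps.
Proof.
have : 0 < N%:R^-1 :> R by rewrite invr_gt0.
have : N%:R^-1 <= 1 :> R by rewrite invf_le1// ler1n.
by rewrite /fp_eps; move: (_^-1) r0 r1 => x; nra.
Qed.

Let weight_ge0 l : (l <= N)%N -> 0 <= 1 - l%:R / N%:R :> R.
Proof. by move=> lN; rewrite subr_ge0 ler_pdivrMr// mul1r ler_nat. Qed.

Let coef_ge0 l : (l <= N)%N -> 0 <= fp_coef l.
Proof. by move=> lN; rewrite mulr_ge0 ?weight_ge0 ?exprn_ge0. Qed.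

Let coef_convex l : (l < m)%N ->
  0 <= fp_coef l - 2 * fp_coef l.+1 + fp_coef l.+2.
Proof.
move=> lm; have c0 : 0 <= 1 - l.+1%:R / N%:R :> R by rewrite weight_ge0// ltnW.
have -> : fp_coef l - 2 * fp_coef l.+1 + fp_coef l.+2 =
    r ^+ l * ((1 - l.+1%:R / N%:R) * (1 - r) ^+ 2 + (1 - r) * (1 + r) / N%:R).
  rewrite /fp_coef !exprS -(natr1 l.+1) -(natr1 l); field.
  by rewrite gt_eqF.
rewrite mulr_ge0 ?exprn_ge0// addr_ge0//; first by rewrite mulr_ge0 ?sqr_ge0.
by rewrite divr_ge0 ?ler0n// mulr_ge0 ?subr_ge0// addr_ge0.
Qed.

Let rho l := complex.Re (tau ^+ l).

Let rho_le l : `|rho l| <= 1.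
Proof.
have : rho l ^+ 2 <= 1.
  by rewrite (le_trans (Re_sqr_le _))// nsqX tau1 expr1n.
by rewrite -(real_normK (num_real _)) expr_le1.
Qed.

Let kernelE : fp_kernel = 1 + 2 * \sum_(0 <= l < m) fp_coef l.+1 * rho l.+1.
Proof. by rewrite /fp_kernel Re_sum; under eq_bigr do rewrite ReZ. Qed.

Let nsq_subr1 : nsq (1 - tau) = 2 - 2 * rho 1.
Proof.
move: tau1; rewrite /rho expr1; case: tau => a b; rewrite /nsq /=.
by rewrite sub0r => e; lra.
Qed.

(** The coefficients are convex and vanish at [N], so [convex_cosine_sum] applies; its factor
    [2 - 2 rho 1] is the squared chord, and [fp_eps] is [1 - fp_coef 1]. *)
Lemma fp_kernel_far : 0 <= nsq (1 - tau) * fp_kernel <= 4 * fp_eps.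
Proof.
have rec l : rho l.+2 = 2 * rho 1 * rho l.+1 - rho l.
  rewrite /rho expr1 (exprSr _ l.+1) !(exprSr _ l).
  move: tau1; case: (tau ^+ l) => x y; case: tau => a b; rewrite /nsq /= => e.
  have eb : b * b = 1 - a * a by lra.
  transitivity (x * (a * a - b * b) - 2 * a * b * y); first by ring.
  by rewrite eb; ring.
have -> : fp_eps = 1 - fp_coef 1 by rewrite /fp_eps /fp_coef expr1 mul1r.
rewrite nsq_subr1 kernelE convex_cosine_sum//.
- by rewrite /fp_coef mul0r subr0 mulr1.
- exact/coef_ge0.
- by rewrite /fp_coef divff ?subrr ?mul0r// gt_eqF.
Qed.

(** By Bernoulli's inequality [1 - l / N <= (1 - 1 / N) ^ l], so the coefficients are dominated by a
    geometric sequence of ratio [1 - fp_eps]. *)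
Lemma fp_kernel_near : fp_kernel <= 2 / fp_eps.
Proof.
set x := (1 - N%:R^-1) * r.
have x0 : 0 <= x by rewrite mulr_ge0// subr_ge0 invf_le1// ler1n.
have le_geo l : fp_coef l <= x ^+ l.
  rewrite /x exprMn ler_wpM2r ?exprn_ge0//.
  elim: l => [|l IHl]; first by rewrite mul0r subr0.
  have i0 : 0 <= 1 - N%:R^-1 :> R by rewrite subr_ge0 invf_le1// ler1n.
  rewrite exprS; apply: le_trans (ler_wpM2l i0 IHl); rewrite -(natr1 l).
  rewrite -subr_ge0 (_ : _ - _ = l%:R * N%:R^-1 ^+ 2); last by ring.
  by rewrite mulr_ge0 ?sqr_ge0.
have S : \sum_(0 <= l < m) fp_coef l.+1 * rho l.+1 <= \sum_(0 <= l < m) x ^+ l.+1.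
  apply: ler_sum_nat => l /andP[_ lm]; apply: le_trans (le_geo _).
  apply: ler_piMr; first exact: coef_ge0 (leqW lm).
  exact: le_trans (ler_norm _) (rho_le _).
rewrite ler_pdivlMr ?fp_eps_gt0// kernelE.
have G : fp_eps * \sum_(0 <= l < m) x ^+ l.+1 <= x.
  rewrite (_ : _ * _ = x - x ^+ m.+1) ?gerBl ?exprn_ge0//.
  rewrite /fp_eps -/x; elim: (m) => [|k IHk]; first by rewrite big_geq// expr1; ring.
  by rewrite big_nat_recr//= mulrDr IHk !exprS; ring.
have e0 := fp_eps_gt0; have := ler_wpM2r (ltW e0) S.
by move: G e0; rewrite /fp_eps -/x; lra.
Qed.

Lemma fp_kernel_ge0 : 0 <= fp_kernel.
Proof.
have /andP[k0 _] := fp_kernel_far.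
(* The chord vanishes at [tau = 1], but there the kernel is a sum of nonnegative coefficients. *)
have [e|e] := eqVneq tau 1; last first.
  move: k0; rewrite pmulr_rge0// lt_def nsq_ge0 nsq_eq0 andbT.
  by rewrite subr_eq0 eq_sym.
rewrite kernelE addr_ge0// mulr_ge0// big_seq sumr_ge0// => l.
rewrite mem_index_iota => /andP[_ lm].
by rewrite /rho e expr1n mulr1 (coef_ge0 (leqW lm)).
Qed.

End FejerPoisson.

(** * Chords and angles *)

Section Chords.
Variable R : realType.
Implicit Types (x y t : R).

Lemma sin_mvt y : 0 < y -> exists2 c, 0 < c < y & sin y = cos c * y.
Proof.
move=> y0; have [|c ci] := @MVT R sin cos 0 y y0.
- by apply: continuous_subspaceT => x; exact: continuous_sin.
rewrite sin0 !subr0 => e; exists c => //.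
Qed.

Lemma sin_sqr_le y : 0 <= y -> sin y ^+ 2 <= y ^+ 2.
Proof.
rewrite le_eqVlt => /predU1P[<-|y0]; first by rewrite sin0.
have [c _ ->] := sin_mvt y0; rewrite exprMn ler_piMl ?sqr_ge0//.
Qed.

Lemma cos_pi4 t : - (pi / 4) <= t <= pi / 4 -> 2^-1 <= cos t.
Proof.
have p0 := pi_gt0 R.
move=> /andP[t1 t2]; have c4 : 2^-1 <= cos (pi / 4 : R).
  have h : 0 < cos (pi / 4 : R) by apply: cos_gt0_pihalf; apply/andP; split; lra.
  have := cos_mulr2n (pi / 4 : R).
  have -> : (pi / 4) *+ 2 = pi / 2 :> R by rewrite -mulr_natr; field.
  by rewrite cos_pihalf; move: h; move: (cos _) => u; nra.
apply: le_trans c4 _; rewrite -(cos_norm t).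
have tn : `|t| <= pi / 4 by rewrite ler_norml t1 t2.
rewrite le_eqVlt; have [->|ne] := eqVneq `|t| (pi / 4); first by rewrite eqxx.
have i1 : `|t| \in `[0, pi] by rewrite in_itv/= normr_ge0 (le_trans tn)//; lra.
have i2 : pi / 4 \in `[0, pi : R] by rewrite in_itv/=; apply/andP; split; lra.
by apply/orP; right; rewrite ltr_cos// lt_neqAle ne.
Qed.

(** Up to [pi / 4] the mean value theorem gives [y / 2]; beyond, [sin y = cos (y - pi / 2)] is at
    least [1 / 2] while [pi < 4] gives [y < 3]. *)
Lemma sin_ge y : 0 <= y <= 3 * pi / 4 -> y / 6 <= sin y.
Proof.
have p0 := pi_gt0 R; have p4 := pihalf_lt2 R.
move=> /andP[y0 y3]; have [yp|yp] := leP y (pi / 4).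
  move: y0; rewrite le_eqVlt => /predU1P[<-|y0]; first by rewrite sin0 mul0r.
  have [c /andP[c0 cy] ->] := sin_mvt y0.
  have h : 2^-1 <= cos c by apply: cos_pi4; apply/andP; split; lra.
  by rewrite mulrC ler_pM2r//; lra.
have : 2^-1 <= cos (y - pi / 2) by apply: cos_pi4; apply/andP; split; lra.
by rewrite cosBpihalf; lra.
Qed.

Lemma nsq_chord t : nsq (1 - expc t) = 4 * sin (t / 2) ^+ 2.
Proof.
rewrite /nsq /= sub0r sqrrN.
have := cos_mulr2n (t / 2); have -> : (t / 2) *+ 2 = t by rewrite -mulr_natr divfK// pnatr_eq0.
have := cos2Dsin2 t; have := cos2Dsin2 (t / 2).
by move: (cos _) (sin _) (cos _) (sin _) => a b c d; lra.
Qed.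

Lemma chord_le t : 0 <= t -> nsq (1 - expc t) <= t ^+ 2.
Proof.
move=> t0; rewrite nsq_chord; have t2 : 0 <= t / 2 by rewrite divr_ge0.
by have := sin_sqr_le t2; move: (sin _) => s; lra.
Qed.

(** The range exceeds [pi] because, after rounding to the nearest root, angles reach half a turn
    plus half a step. *)
Lemma chord_ge t : `|t| <= 3 * pi / 2 -> (t / 6) ^+ 2 <= nsq (1 - expc t).
Proof.
move=> t3; rewrite nsq_chord.
have -> : sin (t / 2) ^+ 2 = sin (`|t| / 2) ^+ 2.
  by case: ler0P => _ //; rewrite mulNr sinN sqrrN.
have -> : (t / 6) ^+ 2 = (`|t| / 6) ^+ 2 by rewrite !exprMn real_normK ?num_real.
have := @sin_ge (`|t| / 2); rewrite divr_ge0//= => /(_ ltac:(lra)).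
by have := normr_ge0 t; move: (sin _) => s; nra.
Qed.

Lemma circle_angle (z : R[i]) : nsq z = 1 -> exists2 t, 0 <= t & z = expc t.
Proof.
case: z => a b; rewrite /nsq /= => ab.
have a1 : -1 <= a <= 1 by apply/andP; split; nra.
have [b0|b0] := leP 0 b.
  exists (acos a); first by rewrite acos_ge0.
  rewrite /expc acosK// sin_acos//; congr (_ +i* _).
  by rewrite (_ : 1 - a ^+ 2 = b ^+ 2) ?sqrtr_sqr ?ger0_norm//; lra.
exists (- acos a + pi *+ 2).
  by have := acos_lepi a1; have := pi_gt0 R; rewrite mulr2n; lra.
rewrite /expc cosD2pi sinD2pi cosN sinN acosK// sin_acos//; congr (_ +i* _).
by rewrite (_ : 1 - a ^+ 2 = b ^+ 2) ?sqrtr_sqr ?ltr0_norm ?opprK//; lra.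
Qed.

End Chords.

(** * Spacing of the roots of unity *)

Section SpreadRoots.
Variable R : realType.

(* [e] generates the [2 n]-th roots of unity in one of the two directions around the circle *)
Definition spread_root (n : nat) (e : R[i]) :=
  [/\ nsq e = 1, (2 * n).-primitive_root e,
    nsq (1 - e) <= (8 / (2 * n)%:R) ^+ 2 &
    forall z, nsq z = 1 -> exists2 a, (n <= a)%N &
      forall L i, (0 < L)%N -> (a - n <= i < a + n)%N -> ~~ (a - L <= i < a + L)%N ->
      (L%:R / (6 * (2 * n)%:R)) ^+ 2 <= nsq (z - e ^+ i)].

Lemma spread_rootJ n e : spread_root n e -> spread_root n (conjc e).
Proof.
case=> e1 pe e8 far; split=> //.
- by rewrite nsqJ.
- by rewrite (fmorph_primitive_root (@conjc R)).
- by rewrite -[1]conjc1 -conjcB nsqJ.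
move=> z z1; have [|a na fa] := far (conjc z); first by rewrite nsqJ.
exists a => // L i L0 ai La; rewrite -conjcX -[z]conjcK -conjcB nsqJ.
exact: fa.
Qed.

Lemma spread_rootc n : (0 < n)%N -> spread_root n (rootc R (2 * n)).
Proof.
move=> n0; set N := (2 * n)%N; have N0 : 0 < N%:R :> R by rewrite ltr0n muln_gt0.
have p0 := pi_gt0 R; have p2 := pi_ge2 R; have p4 := pihalf_lt2 R.
split.
- exact: nsq_rootc.
- by apply: rootc_prim; rewrite muln_gt0.
- have h : 0 <= pi *+ 2 / N%:R :> R by rewrite divr_ge0 ?ler0n// mulrn_wge0// ltW.
  apply: le_trans (chord_le h) _.
  have h8 : 0 <= 8 / N%:R :> R by rewrite divr_ge0.
  by rewrite ler_pXn2r ?nnegrE// ler_pM2r ?invr_gt0// mulr2n; lra.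
move=> z z1; have [t t0 zt] := circle_angle z1.
(* Adding one half before truncation makes [j] the index of the root nearest to [z]; the shift by
   [N] keeps [a - n] an honest subtraction. *)
set w := t * N%:R / (pi *+ 2) + 2^-1.
have w0 : 0 <= w.
  by rewrite addr_ge0// divr_ge0//; [rewrite mulr_ge0 ?ler0n | rewrite mulrn_wge0// ltW].
have /andP[w1 w2] := truncn_itv w0.
set j := Num.truncn w in w1 w2; exists (j + N)%N; first by rewrite /N; lia.
move=> L i L0 ai La.
(* Up to a full turn, [y] counts the steps from the root of index [i] to [z]: at most [n + 1/2] in
   the large window, at least [L / 2] outside the small one. *)
set y := w - 2^-1 - i%:R + N%:R; pose q : R := pi *+ 2 / N%:R.
have -> : nsq (z - rootc R N ^+ i) = nsq (1 - expc (q * y)).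
  have -> : z = expc (q * y) * rootc R N ^+ i.
    rewrite rootcX -expcD -[_ *+ i]mulr_natr -mulrDr zt.
    rewrite (_ : _ * _ = t + pi *+ 2); last first.
      rewrite /y /w /q; move: (pi : R) p0 => P P0.
      by rewrite -mulr_natr; field; rewrite (gt_eqF N0) (gt_eqF P0).
    by rewrite expcD expc2pi mulr1.
  rewrite -[X in nsq (_ - X)]mul1r -mulrBl nsqM nsqX nsq_rootc expr1n mulr1.
  by rewrite -nsqN opprB.
have NE : N%:R = 2 * n%:R :> R by rewrite natrM.
have n1 : 1 <= n%:R :> R by rewrite ler1n.
have [i1 i2] : (j + N <= i + n)%N /\ (i + 1 <= j + N + n)%N by lia.
have i3 : (i + 1 + L <= j + N)%N \/ (j + N + L <= i)%N by lia.
rewrite -(ler_nat R) !natrD in i1; rewrite -(ler_nat R) !natrD in i2.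
have yn : `|y| <= n%:R + 2^-1 by rewrite ler_norml /y; apply/andP; split; lra.
have yL : L%:R / 2 <= `|y|.
  have L1 : 1 <= L%:R :> R by rewrite ler1n.
  rewrite ler_normr /y; apply/orP.
  by case: i3; rewrite -(ler_nat R) !natrD => i3; [left | right]; lra.
have px : 0 < q by rewrite divr_gt0// pmulrn_lgt0.
have qn : q * n%:R = pi by rewrite /q NE; move: (pi : R) => P; rewrite -mulr_natr; field; rewrite gt_eqF// ltr0n.
have qpi : q <= pi by rewrite -qn ler_peMr// ltW.
have x3 : `|q * y| <= 3 * pi / 2.
  rewrite normrM (gtr0_norm px).
  by have := ler_wpM2l (ltW px) yn; rewrite mulrDr qn; lra.
apply: le_trans _ (chord_ge x3).
have h1 : L%:R / N%:R <= q * `|y|.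
  have := ler_wpM2l (ltW px) yL; apply: le_trans.
  rewrite (_ : q * (L%:R / 2) = pi * (L%:R / N%:R)); last first.
    by rewrite /q; move: (pi : R) => P; rewrite -[P *+ 2]mulr_natr; field; rewrite (gt_eqF N0).
  by rewrite ler_peMl ?divr_ge0 ?ler0n//; lra.
have -> : (q * y / 6) ^+ 2 = (q * `|y| / 6) ^+ 2.
  by rewrite !exprMn real_normK ?num_real.
rewrite -/N; have -> : L%:R / (6 * N%:R) = L%:R / N%:R / 6 :> R by field; rewrite gt_eqF.
have h2 : 0 <= L%:R / N%:R :> R by rewrite divr_ge0 ?ler0n.
have h3 : 0 <= L%:R / N%:R / 6 :> R by rewrite divr_ge0.
have h4 : 0 <= q * `|y| / 6 by apply: divr_ge0 => //; rewrite mulr_ge0// ltW.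
by rewrite ler_pXn2r ?nnegrE// ler_pM2r ?invr_gt0.
Qed.

End SpreadRoots.

(** * Upper bound for the Hankel form *)

Lemma sum_periodic (V : zmodType) (F : nat -> V) (N s : nat) :
  (forall i, F (i + N)%N = F i) ->
  \sum_(s <= i < s + N) F i = \sum_(0 <= i < N) F i.
Proof.
move=> FN; elim: s => [//|s <-].
have [->|N0] := posnP N; first by rewrite !addn0 !big_geq.
have h : (s < s + N)%N by rewrite -[X in (X < _)%N]addn0 ltn_add2l.
by rewrite addSn big_nat_recr//= (big_ltn h) FN addrC.
Qed.

Lemma weighted_variance (R : realDomainType) (N : nat) (w p : nat -> R) (A : R) :
  (forall x, 0 <= w x) -> \sum_(0 <= x < N) w x = 1 ->
  0 <= \sum_(0 <= x < N) p x ^+ 2 * w x - (\sum_(0 <= x < N) p x * w x) ^+ 2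
    <= \sum_(0 <= x < N) w x * (p x - A) ^+ 2.
Proof.
move=> w0 w1; set P := \sum_(0 <= x < N) p x * w x.
have E c : \sum_(0 <= x < N) w x * (p x - c) ^+ 2 =
    \sum_(0 <= x < N) p x ^+ 2 * w x - P ^+ 2 + (P - c) ^+ 2.
  transitivity (\sum_(0 <= x < N) (p x ^+ 2 * w x - 2 * c * (p x * w x) + c ^+ 2 * w x)).
    by apply: eq_bigr => x _; ring.
  by rewrite big_split sumrB /= -!mulr_sumr w1 -/P; ring.
apply/andP; split; last by rewrite E lerDl sqr_ge0.
have := E P; rewrite subrr expr0n addr0 => <-.
by apply: sumr_ge0 => x _; rewrite mulr_ge0 ?sqr_ge0.
Qed.

Section ConjugateKernels.
Variables (R : realType) (n : nat) (e : R[i]).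
Hypotheses (n0 : (0 < n)%N) (se : spread_root n e).
Notation C := R[i].
Let N := (2 * n)%N.

(** The weight at 0 is halved because [kern] takes twice the real part. *)
Definition fp_weight (l : nat) : R :=
  if l == 0%N then (2 * N%:R)^-1 else (1 - l%:R / N%:R) / N%:R.

Definition fp_poly (x : nat) : {poly C} :=
  \poly_(l < N) ((fp_weight l)%:C * conjc (e ^+ x) ^+ l).

Let N0 : 0 < N%:R :> R. Proof. by rewrite ltr0n muln_gt0. Qed.
Let e1 : nsq e = 1. Proof. by case: se. Qed.
Let pe : N.-primitive_root e. Proof. by case: se. Qed.

Let ex1 x : nsq (e ^+ x) = 1.
Proof. by rewrite nsqX e1 expr1n. Qed.

Lemma kern_fp (r : R) (zeta : C) x :
  kern fp_poly (r%:C * zeta) x =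
  N%:R^-1 * fp_kernel N.-1 r (zeta * conjc (e ^+ x)).
Proof.
have NS : N = N.-1.+1 by rewrite prednK// muln_gt0.
rewrite /kern horner_poly -(big_mkord xpredT (fun l => (fp_weight l)%:C *
  conjc (e ^+ x) ^+ l * (r%:C * zeta) ^+ l)) [in LHS]NS.
rewrite big_nat_recl// ReD !expr0 !mulr1 /fp_kernel mulrDr mulrDr mulr1; congr (_ + _).
  by rewrite /fp_weight /=; field; rewrite gt_eqF.
rewrite [RHS]mulrCA; congr (_ * _); rewrite -ReZ; congr complex.Re.
rewrite mulr_sumr; apply: eq_bigr => l _.
rewrite /fp_weight /fp_coef -NS /= [(_ / N%:R)%:C]rcM [(_ * r ^+ _)%:C]rcM.
have -> : (r ^+ l.+1)%:C = r%:C ^+ l.+1 by rewrite rmorphXn.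
by rewrite !exprMn; ring.
Qed.

Lemma kern_periodic z x : kern fp_poly z (x + N) = kern fp_poly z x.
Proof.
by rewrite /kern /fp_poly exprD (prim_expr_order pe) mulr1.
Qed.

Lemma sum_kern z : \sum_(0 <= x < N) kern fp_poly z x = 1.
Proof.
have NS : N = N.-1.+1 by rewrite prednK// muln_gt0.
rewrite -mulr_sumr -Re_sum.
have -> : \sum_(0 <= x < N) (fp_poly x).[z] =
    \sum_(0 <= l < N) (fp_weight l)%:C * z ^+ l *
      \sum_(0 <= x < N) (e ^+ x) ^+ 0 * conjc ((e ^+ x) ^+ l).
  under eq_bigr => x _ do rewrite horner_poly -(big_mkord xpredT (fun l =>
    (fp_weight l)%:C * conjc (e ^+ x) ^+ l * z ^+ l)).
  rewrite exchange_big /=; apply: eq_bigr => l _.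
  rewrite mulr_sumr; apply: eq_bigr => x _.
  by rewrite expr0 mul1r (conjcX (e ^+ x) l); ring.
transitivity (2 * complex.Re (\sum_(0 <= l < N)
    (fp_weight l)%:C * z ^+ l * (if (0 == l)%N then N%:R else 0))).
  congr (_ * complex.Re _); apply: eq_big_nat => l /andP[_ lN].
  by rewrite (orthogonality e1 pe) ?muln_gt0.
rewrite NS big_nat_recl// big1 ?addr0 => [|l _]; last by rewrite mulr0.
rewrite -NS /= expr0 mulr1 -(rmorph_nat (real_complex R)) -rcM /= /fp_weight /=.
by field; rewrite gt_eqF.
Qed.

Let polar (z : C) : nsq z <= 1 ->
  exists r zeta, [/\ 0 <= r, r <= 1, nsq zeta = 1 & z = r%:C * zeta].
Proof.
move=> z1; set r := Num.sqrt (nsq z).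
have r0 : 0 <= r by rewrite sqrtr_ge0.
have r2 : r ^+ 2 = nsq z by rewrite sqr_sqrtr ?nsq_ge0.
have [rz|rn] := eqVneq r 0.
  exists 0, 1; rewrite ler01 nsq1; split=> //.
  by apply/eqP; rewrite mul0r -nsq_eq0 -r2 rz expr0n.
exists r, (r^-1%:C * z); split=> //.
- by rewrite -(expr_le1 (n := 2))// r2.
- by rewrite nsqM nsq_real -r2 -exprMn mulVf// expr1n.
- by rewrite mulrA -rcM divff// mul1r.
Qed.

Let tau1 zeta x : nsq zeta = 1 -> nsq (zeta * conjc (e ^+ x)) = 1.
Proof. by move=> z1; rewrite nsqM nsqJ ex1 z1 mulr1. Qed.

Let chordE zeta x : nsq (1 - zeta * conjc (e ^+ x)) = nsq (zeta - e ^+ x).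
Proof.
have -> : zeta - e ^+ x = - ((1 - zeta * conjc (e ^+ x)) * e ^+ x).
  by rewrite mulrBl mul1r -mulrA [conjc _ * _]mulrC mulcJ ex1 mulr1 opprB.
by rewrite nsqN nsqM ex1 mulr1.
Qed.

Lemma kern_ge0 z x : nsq z <= 1 -> 0 <= kern fp_poly z x.
Proof.
move=> /polar[r [zeta [r0 r1 z1 ->]]]; rewrite kern_fp mulr_ge0 ?invr_ge0 ?ler0n//.
by rewrite fp_kernel_ge0// tau1.
Qed.

Variables (b : nat -> R) (B : R).
Hypothesis B0 : 0 < B.
Hypothesis b_per : forall i, b (i + N)%N = b i.
Hypothesis bmo : forall l r, (l < r)%N -> (r - l <= N)%N ->
  \sum_(l <= i < r) `|b i - avg b l r| <= B * (r - l)%:R.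

(** A variance is at most the second moment about any constant. The average of [b] over the window
    of radius [M] around the direction of [z] is used, with [M] comparable to [N eps], the kernel
    width in steps, so that [sum_decay] applies. *)
Lemma kern_variance_le z : nsq z <= 1 ->
  0 <= \sum_(0 <= x < N) b x ^+ 2 * kern fp_poly z x -
    (\sum_(0 <= x < N) b x * kern fp_poly z x) ^+ 2 <= 552 * 288 * B ^+ 2.
Proof.
move=> z1; have w0 x := kern_ge0 x z1.
suff [A hA] : exists A, \sum_(0 <= x < N) kern fp_poly z x * (b x - A) ^+ 2 <= 552 * 288 * B ^+ 2.
  have /andP[-> /le_trans->//] := weighted_variance b A w0 (sum_kern z).
have [r [zeta [r0 r1 zeta1 zE]]] := polar z1.
have [_ _ _ /(_ zeta zeta1) [a na far]] := se.
pose eps := fp_eps N.-1 r.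
have NS : N.-1.+1 = N by rewrite prednK// muln_gt0.
have epsE : eps = 1 - (1 - N%:R^-1) * r by rewrite /eps /fp_eps NS.
have eps0 : 0 < eps by apply: fp_eps_gt0.
have Ni : 0 < N%:R^-1 :> R by rewrite invr_gt0.
have Ni1 : N%:R^-1 <= 1 :> R by rewrite invf_le1// ler1n muln_gt0.
have eps1 : eps <= 1 by rewrite epsE gerBl mulr_ge0// subr_ge0.
have epsN : 1 <= eps * N%:R.
  by rewrite -ler_pdivrMr// mul1r epsE; move: Ni Ni1 r0 r1; move: (_^-1) => y; nra.
set t := eps * N%:R in epsN.
have /andP[t1 t2] := truncn_itv (le_trans ler01 epsN).
pose M := minn (Num.truncn t).+1 n.
have M0 : (0 < M)%N by rewrite leq_min.
have Mn : (M <= n)%N by rewrite geq_minr.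
have MR0 : 0 < M%:R :> R by rewrite ltr0n.
have Mt : M%:R <= 2 * t.
  have : M%:R <= (Num.truncn t).+1%:R :> R by rewrite ler_nat geq_minl.
  by rewrite -natr1; lra.
have tM : t <= 2 * M%:R.
  rewrite /M /minn; case: ifP => _.
    by move: t2; rewrite -natr1; have := ler0n R (Num.truncn t); lra.
  by rewrite /t /N natrM ler_piMl// mulr_ge0.
exists (avg b (a - M) (a + M)).
rewrite -(@sum_periodic _ _ _ (a - n)); last first.
  by move=> i; rewrite kern_periodic b_per.
have -> : (a - n + N = a + n)%N by rewrite /N mul2n -addnn addnA subnK.
have kernE i : kern fp_poly z i = N%:R^-1 * fp_kernel N.-1 r (zeta * conjc (e ^+ i)).
  by rewrite zE kern_fp.
(* Here [C = 288]. Near the centre the weight is at most [2 / t <= 4 / M]; at distance [L] it is at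
   most [144 t / L ^ 2], and [t <= 2 M]. *)
apply: (sum_decay B0 bmo na M0 Mn) => //.
- move=> i; rewrite kernE.
  have := fp_kernel_near N.-1 r0 r1 (tau1 i zeta1); rewrite -/eps => h.
  apply: (@le_trans _ _ (N%:R^-1 * (2 / eps))); first by rewrite ler_pM2l.
  rewrite (_ : N%:R^-1 * (2 / eps) = 2 / t); last by rewrite /t; field; rewrite !gt_eqF.
  have t0 : 0 < t by rewrite mulr_gt0.
  by rewrite ler_pdivrMr// mulrAC ler_pdivlMr//; lra.
move=> L i ML ai Li; have L0 := leq_trans M0 ML.
have LR0 : 0 < L%:R :> R by rewrite ltr0n.
rewrite kernE; have := far L i L0 ai Li; rewrite -chordE -/N => h.
have /andP[_] := fp_kernel_far N.-1 r0 r1 (tau1 i zeta1); rewrite -/eps => h2.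
have k0 := fp_kernel_ge0 N.-1 r0 r1 (tau1 i zeta1).
have h3 : (L%:R / (6 * N%:R)) ^+ 2 * fp_kernel N.-1 r (zeta * conjc (e ^+ i)) <= 4 * eps.
  by apply: le_trans h2; rewrite ler_wpM2r.
rewrite ler_pdivlMr ?exprn_gt0// -(ler_pM2r (_ : 0 < (36 * N%:R)^-1)) ?invr_gt0 ?mulr_gt0//.
rewrite (_ : _ / _ = (L%:R / (6 * N%:R)) ^+ 2 * fp_kernel N.-1 r (zeta * conjc (e ^+ i))); last first.
  by field; rewrite gt_eqF.
apply: le_trans h3 _; rewrite ler_pdivlMr ?mulr_gt0//.
by rewrite (_ : 4 * eps * (36 * N%:R) = 144 * t); [lra | rewrite /t; ring].
Qed.

End ConjugateKernels.

Lemma sum_coef_mul (K : comNzRingType) (n N : nat) (f g G : nat -> K) :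
  (2 * n <= N)%N ->
  \sum_(0 <= a < N) ('X * (\poly_(i < n) f i) * \poly_(i < n) g i)`_a * G a =
  \sum_(0 <= j < n) \sum_(0 <= i < n) f i * g j * G (j + i).+1.
Proof.
move=> nN.
have coefE a : ('X * (\poly_(i < n) f i) * \poly_(i < n) g i)`_a =
    \sum_(0 <= j < n) \sum_(0 <= i < n) f i * g j * (a == (j + i).+1)%:R.
  have mono i j : 'X * (f i *: 'X^i) * (g j *: 'X^j) = (f i * g j) *: 'X^((j + i).+1).
    by rewrite -!mul_polyC polyCM exprS exprD; ring.
  rewrite !poly_def [_ * \sum_(i < n) g i *: _]mulr_sumr coef_sum big_mkord.
  apply: eq_bigr => j _; rewrite mulr_sumr mulr_suml coef_sum big_mkord.
  by apply: eq_bigr => i _; rewrite mono coefZ coefXn.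
under eq_bigr => a _ do rewrite coefE mulr_suml.
rewrite exchange_big /=; apply: eq_big_nat => j /andP[_ jn].
under eq_bigr => a _ do rewrite mulr_suml.
rewrite exchange_big /=; apply: eq_big_nat => i /andP[_ ij].
have jiN : ((j + i).+1 < N)%N by lia.
rewrite (bigD1_seq (j + i).+1) ?mem_index_iota ?iota_uniq//= eqxx mulr1.
by rewrite big1 ?addr0// => a /negPf ->; rewrite mulr0 mul0r.
Qed.

Section UpperBound.
Variables (R : realType) (n : nat) (e : R[i]) (phi : nat -> R[i]).
Hypotheses (n0 : (0 < n)%N) (se : spread_root n e).
Notation C := R[i].
Let N := (2 * n)%N.
Hypothesis phi_per : forall i, phi (i + N)%N = phi i.

Definition dft (m : nat) : C :=
  (N%:R^-1)%:C * \sum_(0 <= x < N) phi x * (e ^+ x) ^+ m.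

(** The constant is chosen so that [552 * 288 / (30 * 40) ^ 2 <= 1/8]; the two components together
    then keep the variance below [1/4]. *)
Let small_bmo (b : nat -> R) := forall l r, (l < r)%N -> (r - l <= N)%N ->
  \sum_(l <= i < r) `|b i - avg b l r| <= (30 * 40)^-1 * (r - l)%:R.

Hypothesis re_bmo : small_bmo (fun i => complex.Re (phi i)).
Hypothesis im_bmo : small_bmo (fun i => complex.Im (phi i)).

Lemma variance_split z : variance N phi (fp_poly n e) z =
  (\sum_(0 <= x < N) complex.Re (phi x) ^+ 2 * kern (fp_poly n e) z x -
    (\sum_(0 <= x < N) complex.Re (phi x) * kern (fp_poly n e) z x) ^+ 2) +
  (\sum_(0 <= x < N) complex.Im (phi x) ^+ 2 * kern (fp_poly n e) z x -
    (\sum_(0 <= x < N) complex.Im (phi x) * kern (fp_poly n e) z x) ^+ 2).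
Proof.
rewrite /variance /nsq Re_sum Im_sum.
have -> : \sum_(0 <= x < N) (complex.Re (phi x) ^+ 2 + complex.Im (phi x) ^+ 2) *
    kern (fp_poly n e) z x =
  \sum_(0 <= x < N) complex.Re (phi x) ^+ 2 * kern (fp_poly n e) z x +
  \sum_(0 <= x < N) complex.Im (phi x) ^+ 2 * kern (fp_poly n e) z x.
  by rewrite -big_split; apply: eq_bigr => x _; rewrite mulrDl.
have -> : \sum_(0 <= x < N) complex.Re (phi x * (kern (fp_poly n e) z x)%:C) =
    \sum_(0 <= x < N) complex.Re (phi x) * kern (fp_poly n e) z x.
  by apply: eq_bigr => x _; rewrite mulrC ReZ mulrC.
have -> : \sum_(0 <= x < N) complex.Im (phi x * (kern (fp_poly n e) z x)%:C) =
    \sum_(0 <= x < N) complex.Im (phi x) * kern (fp_poly n e) z x.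
  by apply: eq_bigr => x _; rewrite mulrC ImZ mulrC.
ring.
Qed.

Lemma upper_form_le (f g : nat -> C) :
  complex.Re (\sum_(0 <= j < n) \sum_(0 <= i < n)
    f i * g j * ((1 - (j + i).+1%:R / N%:R)%:C * dft (j + i).+1)) <=
  \sum_(0 <= i < n) nsq (f i) + \sum_(0 <= j < n) nsq (g j).
Proof.
have var_le z : nsq z <= 1 -> 0 <= variance N phi (fp_poly n e) z <= 1/4.
  move=> z1; rewrite variance_split.
  have B0 : 0 < (30 * 40)^-1 :> R by rewrite invr_gt0 mulr_gt0.
  have p1 i : complex.Re (phi (i + N)) = complex.Re (phi i) by rewrite phi_per.
  have p2 i : complex.Im (phi (i + N)) = complex.Im (phi i) by rewrite phi_per.
  have := kern_variance_le n0 se B0 p1 re_bmo z1.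
  have := kern_variance_le n0 se B0 p2 im_bmo z1.
  rewrite -/N; have : 552 * 288 * (30 * 40)^-1 ^+ 2 <= 1 / 8 :> R by lra.
  move: (552 * 288 * _) => c c8 /andP[h1 h2] /andP[h3 h4]; apply/andP; split; lra.
pose F : {poly C} := 'X * \poly_(i < n) f i; pose G : {poly C} := \poly_(i < n) g i.
have F0 : F.[0] = 0 by rewrite hornerM hornerX mul0r.
have := hankel_form_le var_le G F0.
have sum_nsq (h : {poly C}) M : (size h <= M)%N ->
    \sum_(0 <= a < size h) nsq h`_a = \sum_(0 <= a < M) nsq h`_a.
  move=> hM; rewrite (big_cat_nat (n := size h) _ (p := M))//=.
  rewrite [X in _ = _ + X]big1_seq ?addr0// => a /andP[_].
  by rewrite mem_index_iota => /andP[ha _]; rewrite nth_default ?nsq0.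
have sF : (size F <= n.+1)%N.
  by rewrite (leq_trans (size_polyMleq _ _))// size_polyX /= ltnS size_poly.
rewrite (sum_nsq F _ sF) (sum_nsq G n (size_poly _ _)).
have -> : \sum_(0 <= a < n.+1) nsq F`_a = \sum_(0 <= i < n) nsq (f i).
  rewrite big_nat_recl// coefXM /= nsq0 add0r; apply: eq_big_nat => i /andP[_ ni].
  by rewrite coefXM /= coef_poly ni.
have -> : \sum_(0 <= a < n) nsq G`_a = \sum_(0 <= i < n) nsq (g i).
  by apply: eq_big_nat => i /andP[_ ni]; rewrite coef_poly ni.
apply: le_trans; rewrite le_eqVlt; apply/orP; left; apply/eqP; congr complex.Re.
have fgE x : \sum_(0 <= a < size (F * G)) (F * G)`_a * conjc (fp_poly n e x)`_a =
    \sum_(0 <= a < N) (F * G)`_a * conjc (fp_poly n e x)`_a.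
  pose t a := (F * G)`_a * conjc (fp_poly n e x)`_a.
  have tail M : (minn (size (F * G)%R) N <= M)%N ->
      \sum_(0 <= a < M) t a = \sum_(0 <= a < minn (size (F * G)%R) N) t a.
    move=> hM; rewrite (big_cat_nat (n := minn (size (F * G)%R) N) _ (p := M))//=.
    rewrite [X in _ + X]big1_seq ?addr0// => a /andP[_].
    rewrite mem_index_iota geq_min => /andP[/orP[h|h] _].
      by rewrite /t nth_default ?mul0r.
    by rewrite /t coef_poly ltnNge h conjc0 mulr0.
  by rewrite -!/(t _) (tail _ (geq_minl _ _)) (tail _ (geq_minr _ _)).
under [RHS]eq_bigr => x _ do rewrite fgE mulr_sumr.
rewrite [RHS]exchange_big /=.
have := @sum_coef_mul _ n N f g (fun a => (1 - a%:R / N%:R)%:C * dft a) (leqnn N).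
rewrite /= => <-.
rewrite -/F -/G; apply: eq_big_nat => a /andP[_ aN].
(* At index 0, where [fp_weight] is halved, both sides vanish because of the factor ['X] in [F]. *)
have [->|a0] := posnP a.
  rewrite -horner_coef0 hornerM F0 !mul0r big1// => x _.
  by rewrite mul0r mulr0.
rewrite /dft !mulr_sumr; apply: eq_bigr => x _.
rewrite coef_poly aN /fp_weight gtn_eqF// -/N conjcM conjc_real -conjcX conjcK rcM.
by rewrite exprAC; ring.
Qed.

End UpperBound.

(** * Lower bound for the Hankel form *)

Lemma sum_nat_indicator (n a b : nat) :
  (\sum_(0 <= t < n) (a <= t < b) = minn b n - a)%N.
Proof.
elim: n => [|n IHn]; first by rewrite big_geq// minn0 sub0n.
by rewrite big_nat_recr//= IHn; lia.
Qed.

Lemma sum_antidiagonal (K : pzSemiRingType) (n : nat) (F : nat -> nat -> K) (G : nat -> K) :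
  (forall l, (n <= l)%N -> G l = 0) ->
  \sum_(0 <= j < n) \sum_(0 <= i < n) F j i * G (j + i)%N =
  \sum_(0 <= l < n) (\sum_(0 <= j < l.+1) F j (l - j)%N) * G l.
Proof.
move=> G0.
transitivity (\sum_(0 <= j < n) \sum_(0 <= l < n) \sum_(0 <= i < n)
    (if (j + i == l)%N then F j i * G l else 0)).
  apply: eq_bigr => j _; rewrite exchange_big /=; apply: eq_bigr => i _.
  have [jin|jin] := ltnP (j + i) n.
    rewrite (bigD1_seq (j + i)%N) ?mem_index_iota ?iota_uniq//= eqxx.
    by rewrite big1 ?addr0// => l; rewrite eq_sym => /negPf ->.
  rewrite G0// mulr0 big1_seq// => l /andP[_]; rewrite mem_index_iota => /andP[_ ln].
  by case: eqP => // e; move: ln; rewrite -e ltnNge jin.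
rewrite exchange_big /=; apply: eq_big_nat => l /andP[_ ln].
rewrite (big_cat_nat (n := l.+1))//= [X in _ + X]big1_seq ?addr0; last first.
  move=> j /andP[_]; rewrite mem_index_iota => /andP[lj _].
  by rewrite big1// => i _; case: eqP => // e; lia.
rewrite mulr_suml; apply: eq_big_nat => j /andP[_ jl].
rewrite (bigD1_seq (l - j)%N) ?mem_index_iota ?iota_uniq//=; last by lia.
rewrite subnKC// eqxx big1 ?addr0// => i il.
by case: eqP => // e; case/eqP: il; lia.
Qed.

Section HankelCuts.
Variables (R : realType) (n : nat).
Hypothesis n0 : (0 < n)%N.
Notation C := R[i].
Let N := (2 * n)%N.

(** [A2] bounds the square of the operator norm; vectors are sequences, which makes reindexing
    easy. *)
Definition hankel_bounded (A2 : R) (gamma : nat -> C) :=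
  forall v : nat -> C, \sum_(0 <= j < n) nsq (\sum_(0 <= k < n) gamma (j + k)%N * v k) <=
    A2 * \sum_(0 <= k < n) nsq (v k).

Definition fejer_cut (gamma : nat -> C) (l : nat) : C :=
  ((n - l.+1)%:R / n%:R : R)%:C * gamma l.

Let nR : n%:R != 0 :> R. Proof. by rewrite pnatr_eq0 -lt0n. Qed.

(** The cut is an average over [t < n] of compressions that keep the rows [j <= t] and the columns
    [k < n - t - 1]: the entry [(j, k)] is kept for exactly [n - (j + k + 1)] values of [t].
    Cauchy-Schwarz shows that averaging preserves the bound. *)
Lemma fejer_cut_bounded A2 gamma : 0 <= A2 -> hankel_bounded A2 gamma ->
  hankel_bounded A2 (fejer_cut gamma).
Proof.
move=> A0 hG v.
pose w t k : C := if (t + k.+1 < n)%N then v k else 0.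
pose X t j : C := if (j <= t)%N then \sum_(0 <= k < n) gamma (j + k)%N * w t k else 0.
have XE j : \sum_(0 <= k < n) fejer_cut gamma (j + k)%N * v k =
    (n%:R^-1)%:C * \sum_(0 <= t < n) X t j.
  have -> : \sum_(0 <= t < n) X t j = \sum_(0 <= t < n) \sum_(0 <= k < n)
      gamma (j + k)%N * v k * (j <= t < n - k.+1)%N%:R.
    apply: eq_bigr => t _; rewrite /X; case: (leqP j t) => jt /=; last first.
      by rewrite big1// => k _; rewrite mulr0n mulr0.
    apply: eq_bigr => k _; rewrite /w ltn_subRL [(k.+1 + t)%N]addnC.
    by case: ifP => _; rewrite ?mulr1n ?mulr0n ?mulr1// !mulr0.
  rewrite exchange_big /= mulr_sumr; apply: eq_bigr => k _.
  rewrite -mulr_sumr -natr_sum sum_nat_indicator (minn_idPl (leq_subr _ _)).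
  rewrite -subnDA addSn addnC /fejer_cut rcM (rmorph_nat (real_complex R)).
  by rewrite [(k + j)%N]addnC; ring.
have step j : nsq (\sum_(0 <= k < n) fejer_cut gamma (j + k)%N * v k) <=
    n%:R^-1 * \sum_(0 <= t < n) nsq (\sum_(0 <= k < n) gamma (j + k)%N * w t k).
  rewrite XE nsqM nsq_real; apply: (@le_trans _ _ (n%:R^-1 ^+ 2 * (n%:R *
      \sum_(0 <= t < n) nsq (X t j)))).
    by rewrite ler_wpM2l ?sqr_ge0// nsq_sum_le.
  rewrite (_ : n%:R^-1 ^+ 2 * _ = n%:R^-1 * \sum_(0 <= t < n) nsq (X t j)); last by field.
  rewrite ler_wpM2l ?invr_ge0// ler_sum// => t _.
  by rewrite /X; case: ifP => // _; rewrite nsq0 nsq_ge0.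
apply: (@le_trans _ _ (n%:R^-1 * \sum_(0 <= t < n) A2 * \sum_(0 <= k < n) nsq (v k))).
  apply: le_trans (ler_sum _ (fun j _ => step j)) _.
  rewrite -[leLHS]mulr_sumr [in leLHS]exchange_big /=. rewrite ler_wpM2l ?invr_ge0// ler_sum// => t _.
  apply: le_trans (hG (w t)) _; rewrite ler_wpM2l// ler_sum// => k _.
  by rewrite /w; case: ifP => // _; rewrite nsq0 nsq_ge0.
by rewrite sumr_const_nat subn0 -[(A2 * _) *+ n]mulr_natl mulKf.
Qed.

Lemma hankel_bounded_rev A2 gamma : hankel_bounded A2 gamma ->
  hankel_bounded A2 (fun l => gamma (2 * n - 2 - l)%N).
Proof.
move=> hG v; rewrite big_nat_rev add0n.
rewrite [X in A2 * X]big_nat_rev add0n.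
apply: le_trans (hG (fun k => v (n - k.+1)%N)).
rewrite le_eqVlt; apply/orP; left; apply/eqP; apply: eq_big_nat => j /andP[_ jn].
rewrite big_nat_rev add0n; congr nsq; apply: eq_big_nat => k /andP[_ kn].
by congr (gamma _ * _); lia.
Qed.

Section Parseval.
Variable e : R[i].
Hypothesis se : spread_root n e.
Let e1 : nsq e = 1. Proof. by case: se. Qed.
Let pe : N.-primitive_root e. Proof. by case: se. Qed.
Let ex1 x : nsq (e ^+ x) = 1. Proof. by rewrite nsqX e1 expr1n. Qed.

Lemma parseval (h : nat -> C) :
  \sum_(0 <= x < N) nsq (\sum_(0 <= j < n) h j * (e ^+ x) ^+ j) =
  N%:R * \sum_(0 <= j < n) nsq (h j).
Proof.
apply: complexI; rewrite rc_sum rcM rc_sum (rmorph_nat (real_complex R)).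
transitivity (\sum_(0 <= x < N) \sum_(0 <= j < n) \sum_(0 <= k < n)
    h j * conjc (h k) * ((e ^+ x) ^+ j * conjc ((e ^+ x) ^+ k))).
  apply: eq_bigr => x _; rewrite -mulcJ conjc_sum mulr_suml; apply: eq_bigr => j _.
  by rewrite mulr_sumr; apply: eq_bigr => k _; rewrite conjcM; ring.
rewrite exchange_big /= mulr_sumr; apply: eq_big_nat => j /andP[_ jn].
have nN : (n <= N)%N by rewrite /N; lia.
rewrite exchange_big /= (bigD1_seq j) ?mem_index_iota ?iota_uniq//=.
rewrite [X in _ + X]big1_seq ?addr0; last first.
  move=> k /andP[kj]; rewrite mem_index_iota => /andP[_ kn].
  rewrite -mulr_sumr (orthogonality e1 pe) ?(leq_trans _ nN)//.
  by rewrite eq_sym (negPf kj) mulr0.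
by rewrite -mulr_sumr (orthogonality e1 pe) ?(leq_trans _ nN)// eqxx mulcJ mulrC.
Qed.

(** With [q = M / N], the root is within [i] steps of length [8 / N] from 1, and the radial gap is
    [q / 2]; [2 (64 + 1/4) <= 129]. *)
Lemma root_dist i M : (i < M)%N -> (M <= N)%N ->
  nsq (e ^+ i - (1 - M%:R / (2 * N%:R))%:C) <= 129 * (M%:R / N%:R) ^+ 2.
Proof.
move=> iM MN; have [_ _ e8 _] := se; rewrite -/N in e8.
have NR : 0 < N%:R :> R by rewrite ltr0n muln_gt0.
set q : R := M%:R / N%:R.
have -> : e ^+ i - (1 - M%:R / (2 * N%:R))%:C = (e ^+ i - 1) + (q / 2)%:C.
  rewrite (_ : M%:R / (2 * N%:R) = q / 2); last by rewrite /q; field; rewrite gt_eqF.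
  by rewrite rcB; ring.
apply: le_trans (nsqD_le _ _) _; rewrite nsq_real.
have : nsq (e ^+ i - 1) <= 64 * q ^+ 2.
  rewrite subrX1 nsqM -(big_mkord xpredT (fun k => e ^+ k)).
  have -> : 64 * q ^+ 2 = (8 / N%:R) ^+ 2 * M%:R ^+ 2 by rewrite /q; field; rewrite gt_eqF.
  apply: ler_pM; rewrite ?nsq_ge0//; first by rewrite -nsqN opprB.
  apply: le_trans (nsq_sum_le _ _) _.
  under eq_bigr => k _ do rewrite ex1.
  rewrite sumr_const_nat subn0 -expr2 ler_pXn2r ?nnegrE ?ler0n// ler_nat.
  exact: ltnW.
by have := sqr_ge0 q; lra.
Qed.

(** The constant is [psi m], where [m] lies at depth [q / 2] in the disc below the start of the
    block. In [psi y - psi m = (y - m) * sum_j h_j y ^ j] the vector [h] is the cut matrix applied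
    to the powers of [m]. On the block [|y - m| ^ 2 <= 129 q ^ 2], and Parseval over all roots
    bounds the other factor by [N A2 (2 / q)]. *)
Lemma garsia_piece A2 gamma a M : 0 <= A2 -> hankel_bounded A2 gamma ->
  (0 < M)%N -> (M <= N)%N -> exists c : C,
  \sum_(a <= x < a + M)
    nsq (\sum_(0 <= l < n) fejer_cut gamma l * (e ^+ x) ^+ l.+1 - c) <=
  258 * A2 * M%:R.
Proof.
move=> A0 /(fejer_cut_bounded A0) hG M0 MN.
set g := fejer_cut gamma in hG *.
have g0 l : (n <= l)%N -> g l = 0.
  by move=> nl; rewrite /g /fejer_cut (eqP (leqW nl : n - l.+1 == 0)%N) mul0r mul0r.
have NR : 0 < N%:R :> R by rewrite ltr0n muln_gt0.
have MR : 0 < M%:R :> R by rewrite ltr0n.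
set q : R := M%:R / N%:R.
have q0 : 0 < q by rewrite divr_gt0.
have q1 : q <= 1 by rewrite ler_pdivrMr// mul1r ler_nat.
pose r : R := 1 - M%:R / (2 * N%:R).
have rE : r = 1 - q / 2 by rewrite /r /q; field; rewrite gt_eqF.
pose m : C := r%:C * e ^+ a.
pose psi y := \sum_(0 <= l < n) g l * y ^+ l.+1.
pose h j := \sum_(0 <= i < n) g (j + i)%N * m ^+ i.
have psiE y : psi y - psi m = (y - m) * \sum_(0 <= j < n) h j * y ^+ j.
  have -> : \sum_(0 <= j < n) h j * y ^+ j =
      \sum_(0 <= j < n) \sum_(0 <= i < n) (y ^+ j * m ^+ i) * g (j + i)%N.
    apply: eq_bigr => j _; rewrite mulr_suml; apply: eq_bigr => i _; ring.
  rewrite sum_antidiagonal// mulr_sumr -sumrB; apply: eq_bigr => l _.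
  rewrite mulrA -mulrBr mulrC; congr (_ * _).
  rewrite subrXX; congr (_ * _); rewrite -(big_mkord xpredT
    (fun i => y ^+ (l.+1.-1 - i) * m ^+ i)) big_nat_rev /= add0n.
  apply: eq_big_nat => j /andP[_ jl]; rewrite ltnS in jl.
  by rewrite subSS subKn.
exists (psi m).
pose S x := nsq (\sum_(0 <= j < n) h j * (e ^+ x) ^+ j).
have Sper x : S (x + N)%N = S x.
  by rewrite /S exprD (prim_expr_order pe) mulr1.
have Sge x : 0 <= S x by rewrite nsq_ge0.
apply: (@le_trans _ _ (129 * q ^+ 2 * \sum_(a <= x < a + M) S x)).
  rewrite mulr_sumr; apply: ler_sum_nat => x /andP[ax xM].
  rewrite -/(psi _) psiE nsqM ler_wpM2r ?nsq_ge0//.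
  have -> : e ^+ x - m = e ^+ a * (e ^+ (x - a) - r%:C).
    by rewrite mulrBr -exprD subnKC// /m [_ * r%:C]mulrC.
  rewrite nsqM ex1 mul1r root_dist//.
  by rewrite ltn_subLR.
have S1 : \sum_(a <= x < a + M) S x <= \sum_(0 <= x < N) S x.
  rewrite -(sum_periodic a Sper) (big_cat_nat (n := (a + M)%N) _ (p := (a + N)%N))//=;
    rewrite ?leq_addr ?leq_add2l//.
  by rewrite lerDl sumr_ge0.
have S2 : \sum_(0 <= x < N) S x <= N%:R * (A2 * (2 / q)).
  rewrite parseval ler_pM2l//; apply: le_trans (hG _) _; rewrite ler_wpM2l//.
  have r0 : 0 <= r by rewrite rE; lra.
  have r1 : r <= 1 by rewrite rE; lra.
  have mi i : nsq (m ^+ i) = r ^+ 2 ^+ i by rewrite nsqX nsqM ex1 nsq_real mulr1.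
  under eq_bigr => i _ do rewrite mi.
  have : (1 - r ^+ 2) * \sum_(0 <= i < n) r ^+ 2 ^+ i <= 1.
    have := subrX1 (r ^+ 2) n; rewrite -(big_mkord xpredT (fun i => r ^+ 2 ^+ i)).
    have := exprn_ge0 n (exprn_ge0 2 r0).
    move: (\sum_(0 <= i < n) _) (_ ^+ n) => s u; lra.
  have : 0 <= \sum_(0 <= i < n) r ^+ 2 ^+ i.
    by apply: sumr_ge0 => i _; rewrite !exprn_ge0.
  move: (\sum_(0 <= i < n) _) => s s0 hs; rewrite ler_pdivlMr//.
  have qr : q / 2 <= 1 - r ^+ 2 by rewrite rE; move: q0 q1; nra.
  by have := ler_wpM2r s0 qr; lra.
apply: (@le_trans _ _ (129 * q ^+ 2 * (N%:R * (A2 * (2 / q))))).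
  by rewrite ler_wpM2l ?mulr_ge0 ?sqr_ge0// (le_trans S1 S2).
by rewrite /q le_eqVlt; apply/orP; left; apply/eqP; field; rewrite !gt_eqF.
Qed.

End Parseval.

(** Up to a unimodular factor the inner sum is the [j]-th entry of the image of [k |-> y ^ k], whose
    squared norm is [n]; Cauchy-Schwarz over the rows gives another [n]. *)
Lemma middle_piece A2 gamma (y : C) : nsq y = 1 -> hankel_bounded A2 gamma ->
  nsq ((n%:R^-1)%:C * \sum_(0 <= j < n) \sum_(0 <= k < n) gamma (j + k)%N * y ^+ (j + k).+1)
  <= A2.
Proof.
move=> y1 hG; have yk k : nsq (y ^+ k) = 1 by rewrite nsqX y1 expr1n.
rewrite nsqM nsq_real.
have h1 := nsq_sum_le n (fun j => \sum_(0 <= k < n) gamma (j + k)%N * y ^+ (j + k).+1).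
have h2 : \sum_(0 <= j < n) nsq (\sum_(0 <= k < n) gamma (j + k)%N * y ^+ (j + k).+1) <=
    A2 * n%:R.
  have := hG (fun k => y ^+ k); rewrite [X in A2 * X](eq_bigr (fun=> 1)) => [|k _]; last exact: yk.
  rewrite sumr_const_nat subn0; apply: le_trans; rewrite le_eqVlt; apply/orP; left; apply/eqP.
  apply: eq_bigr => j _; rewrite -[RHS]mul1r -(yk j.+1) -nsqM mulr_sumr.
  by congr nsq; apply: eq_bigr => k _; rewrite -addSn exprD; ring.
have nn : 0 < n%:R :> R by rewrite ltr0n.
rewrite expr2 -mulrA ler_pdivrMl// ler_pdivrMl//.
by apply: le_trans h1 _; rewrite ler_pM2l// mulrC.
Qed.

(** For each [j < n] the index range is cut at [j] and [j + n]. Averaged over [j], the three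
    segments become a falling ramp, a tent and a rising ramp, and [y ^ N = 1] turns the last one
    into powers of [conjc y]. *)
Lemma symbol_split gamma (y : C) : y ^+ N = 1 -> nsq y = 1 ->
  \sum_(0 <= l < N.-1) gamma l * y ^+ l.+1 =
  \sum_(0 <= l < n) fejer_cut gamma l * y ^+ l.+1 +
  (n%:R^-1)%:C * \sum_(0 <= j < n) \sum_(0 <= k < n) gamma (j + k)%N * y ^+ (j + k).+1 +
  \sum_(0 <= l < n) fejer_cut (fun l => gamma (2 * n - 2 - l)%N) l * conjc y ^+ l.+1.
Proof.
move=> yN y1.
have cut (g : nat -> C) (w : C) : \sum_(0 <= l < n) fejer_cut g l * w ^+ l.+1 =
    (n%:R^-1)%:C * \sum_(0 <= j < n) \sum_(0 <= l < j) g l * w ^+ l.+1.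
  have -> : \sum_(0 <= j < n) \sum_(0 <= l < j) g l * w ^+ l.+1 =
      \sum_(0 <= j < n) \sum_(0 <= l < n) g l * w ^+ l.+1 * (l.+1 <= j < n)%N%:R.
    apply: eq_big_nat => j /andP[_ jn].
    rewrite [RHS](big_cat_nat (n := j))//= ?(ltnW jn)// [X in _ + X]big1_seq ?addr0.
      by apply: eq_big_nat => l /andP[_ lj]; rewrite lj jn mulr1.
    move=> l /andP[_]; rewrite mem_index_iota => /andP[jl _].
    by rewrite ltnNge jl mulr0.
  rewrite exchange_big /= mulr_sumr; apply: eq_bigr => l _.
  rewrite -mulr_sumr -natr_sum sum_nat_indicator minnn /fejer_cut rcM.
  by rewrite (rmorph_nat (real_complex R)); ring.
rewrite !cut -!mulrDr -!big_split /=.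
have nC : n%:R != 0 :> C by rewrite pnatr_eq0 -lt0n.
have -> : (n%:R^-1)%:C = (n%:R^-1 : C).
  by rewrite (fmorphV (real_complex R)) rmorph_nat.
apply: (mulfI nC); rewrite mulVKf//.
rewrite mulr_natl -[in LHS](subn0 n) -sumr_const_nat.
rewrite big_split /= [X in _ + X]big_nat_rev -big_split /= add0n.
apply: eq_big_nat => j /andP[_ jn].
rewrite (big_cat_nat (n := j) _ (p := N.-1))//=; last by rewrite /N; lia.
rewrite (big_cat_nat (n := (j + n)%N) _ (p := N.-1))//= ?leq_addr//; last by rewrite /N; lia.
rewrite -addrA; congr (_ + (_ + _)).
  rewrite -{1}(add0n j) big_addn [(j + n - j)%N]addKn.
  by apply: eq_bigr => k _; rewrite [(k + j)%N]addnC.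
rewrite -{1}[(j + n)%N]add0n big_addn.
have -> : (N.-1 - (j + n) = n - j.+1)%N by rewrite /N; lia.
rewrite big_nat_rev add0n; apply: eq_big_nat => k /andP[_ kn].
have -> : (n - j.+1 - k.+1 + (j + n) = 2 * n - 2 - k)%N by lia.
congr (_ * _).
have yk : nsq (y ^+ k.+1) = 1 by rewrite nsqX y1 expr1n.
rewrite -conjcX -(invc_nsq1 yk).
have y0 : y ^+ k.+1 != 0 by rewrite -nsq_eq0 yk oner_eq0.
apply: (mulIf y0); rewrite mulVf// -exprD -yN; congr (_ ^+ _); rewrite /N; lia.
Qed.

End HankelCuts.

(** * Mean oscillation of the symbol on blocks of roots *)

Section Combine.
Variables (R : realType) (n : nat) (e : R[i]) (gamma : nat -> R[i]).
Hypotheses (n0 : (0 < n)%N) (se : spread_root n e).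
Notation C := R[i].
Let N := (2 * n)%N.

Definition symbol (x : nat) : C := \sum_(0 <= l < N.-1) gamma l * (e ^+ x) ^+ l.+1.

Definition cavg (phi : nat -> C) l r : C := ((r - l)%:R^-1)%:C * \sum_(l <= i < r) phi i.

Let e1 : nsq e = 1. Proof. by case: se. Qed.
Let pe : N.-primitive_root e. Proof. by case: se. Qed.
Let ex1 x : nsq (e ^+ x) = 1. Proof. by rewrite nsqX e1 expr1n. Qed.
Let exN x : (e ^+ x) ^+ N = 1.
Proof. by rewrite exprAC (prim_expr_order pe) expr1n. Qed.

Lemma symbol_periodic x : symbol (x + N)%N = symbol x.
Proof. by rewrite /symbol exprD (prim_expr_order pe) mulr1. Qed.

Lemma nsq_normc (z : C) : normc z ^+ 2 = nsq z.
Proof. by case: z => a b; rewrite /= sqr_sqrtr// addr_ge0 ?sqr_ge0. Qed.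

Lemma normc_ge0 (z : C) : 0 <= normc z.
Proof. by case: z => a b; rewrite sqrtr_ge0. Qed.

Lemma Re_cavg phi l r : complex.Re (cavg phi l r) = avg (fun i => complex.Re (phi i)) l r.
Proof. by rewrite /cavg /avg ReZ Re_sum mulrC. Qed.

Lemma Im_cavg phi l r : complex.Im (cavg phi l r) = avg (fun i => complex.Im (phi i)) l r.
Proof. by rewrite /cavg /avg ImZ Im_sum mulrC. Qed.

Lemma nsq_cavg_le phi (c : C) l r : (l < r)%N ->
  \sum_(l <= i < r) nsq (phi i - cavg phi l r) <= \sum_(l <= i < r) nsq (phi i - c).
Proof.
move=> lr; have key (b : nat -> R) d :
    \sum_(l <= i < r) (b i - avg b l r) ^+ 2 <= \sum_(l <= i < r) (b i - d) ^+ 2.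
  by rewrite (sum_sub_sqr _ d)// lerDl mulr_ge0 ?sqr_ge0.
have split_nsq d : \sum_(l <= i < r) nsq (phi i - d) =
    \sum_(l <= i < r) (complex.Re (phi i) - complex.Re d) ^+ 2 +
    \sum_(l <= i < r) (complex.Im (phi i) - complex.Im d) ^+ 2.
  by rewrite -big_split; apply: eq_bigr => i _; rewrite /nsq ReB ImD ImN.
by rewrite !split_nsq Re_cavg Im_cavg lerD.
Qed.

(** The two Garsia pieces cost 258 each and the bounded piece 1, and [3 * 517 <= 40 ^ 2]. The
    average minimises the quadratic deviation, and Cauchy-Schwarz passes to the first moment. *)
Lemma symbol_oscillation A a M : 0 <= A -> hankel_bounded n (A ^+ 2) gamma ->
  (0 < M)%N -> (M <= N)%N ->
  \sum_(a <= x < a + M) normc (symbol x - cavg symbol a (a + M)) <= 40 * A * M%:R.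
Proof.
move=> A0 hG M0 MN; have A2 : 0 <= A ^+ 2 by rewrite sqr_ge0.
have aM : (a < a + M)%N by rewrite -[X in (X < _)%N]addn0 ltn_add2l.
have [c1 h1] := garsia_piece n0 se a A2 hG M0 MN.
have [c2 h2] := garsia_piece n0 (spread_rootJ se) a A2 (hankel_bounded_rev n0 hG) M0 MN.
have h3 : \sum_(a <= x < a + M) nsq (symbol x - (c1 + c2)) <= 3 * 517 * A ^+ 2 * M%:R.
  pose u x := \sum_(0 <= l < n) fejer_cut n gamma l * (e ^+ x) ^+ l.+1 - c1.
  pose v x := \sum_(0 <= l < n)
    fejer_cut n (fun l => gamma (2 * n - 2 - l)%N) l * (conjc e ^+ x) ^+ l.+1 - c2.
  pose w x := (n%:R^-1)%:C * \sum_(0 <= j < n) \sum_(0 <= k < n)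
    gamma (j + k)%N * (e ^+ x) ^+ (j + k).+1.
  have arith (U W V c d : C) : U + W + V - (c + d) = (U - c) + (V - d) + W by ring.
  have sE x : symbol x - (c1 + c2) = u x + v x + w x.
    rewrite /symbol (symbol_split n0 gamma (exN x) (ex1 x)) -/(w x) conjcX /u /v.
    exact: arith.
  have n3 x : nsq (symbol x - (c1 + c2)) <= 3 * (nsq (u x) + nsq (v x) + A ^+ 2).
    rewrite sE; have := middle_piece n0 (ex1 x) hG; rewrite -/(w x).
    case: (u x) (v x) (w x) => [u1 u2] [v1 v2] [w1 w2]; rewrite /nsq /= => hw.
    have := sqr_ge0 (u1 - v1); have := sqr_ge0 (u1 - w1); have := sqr_ge0 (v1 - w1).
    have := sqr_ge0 (u2 - v2); have := sqr_ge0 (u2 - w2); have := sqr_ge0 (v2 - w2).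
    lra.
  apply: le_trans (ler_sum _ (fun x _ => n3 x)) _.
  rewrite -mulr_sumr big_split /= [X in X + _]big_split /= sumr_const_nat addKn -[A ^+ 2 *+ M]mulr_natr.
  have h1' : \sum_(a <= x < a + M) nsq (u x) <= 258 * A ^+ 2 * M%:R := h1.
  have h2' : \sum_(a <= x < a + M) nsq (v x) <= 258 * A ^+ 2 * M%:R := h2.
  by lra.
have := le_trans (nsq_cavg_le symbol (c1 + c2) aM) h3.
set d := cavg _ _ _; move=> h4.
have := nsq_sum_le M (fun i => (normc (symbol (a + i) - d))%:C : C).
have shift (F : nat -> R) : \sum_(0 <= i < M) F (a + i)%N = \sum_(a <= i < a + M) F i.
  apply/esym; rewrite -{1}(add0n a) big_addn [(a + M - a)%N]addKn.
  by apply: eq_bigr => k _; rewrite [(k + a)%N]addnC.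
under [X in _ <= _ * X]eq_bigr => i _ do rewrite nsq_real nsq_normc.
rewrite -rc_sum nsq_real (shift (fun i => normc (symbol i - d))).
rewrite (shift (fun i => nsq (symbol i - d))) => h5.
have S0 : 0 <= \sum_(a <= i < a + M) normc (symbol i - d).
  by apply: sumr_ge0 => i _; exact: normc_ge0.
have K0 : 0 <= 40 * A * M%:R by rewrite !mulr_ge0.
rewrite -(ler_pXn2r (_ : 0 < 2)%N) ?nnegrE//.
apply: le_trans h5 _; apply: le_trans (ler_wpM2l (ler0n R M) h4) _.
have : 0 <= A ^+ 2 * M%:R ^+ 2 by rewrite mulr_ge0 ?sqr_ge0.
by move: (M%:R) => y; lra.
Qed.

Lemma dft_symbol (m : nat) : (0 < m)%N -> (m < N)%N ->
  dft n (conjc e) symbol m = gamma m.-1.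
Proof.
move=> m0 mN; have NS : N = N.-1.+1 by rewrite prednK// muln_gt0.
rewrite /dft -/N.
have -> : \sum_(0 <= x < N) symbol x * (conjc e ^+ x) ^+ m =
    \sum_(0 <= l < N.-1) gamma l *
      \sum_(0 <= x < N) (e ^+ x) ^+ l.+1 * conjc ((e ^+ x) ^+ m).
  under eq_bigr => x _ do rewrite mulr_suml.
  rewrite exchange_big /=; apply: eq_bigr => l _; rewrite mulr_sumr.
  by apply: eq_bigr => x _; rewrite !conjcX mulrA.
transitivity ((N%:R^-1)%:C * \sum_(0 <= l < N.-1)
    (if l == m.-1 then gamma l * N%:R else 0)).
  congr (_ * _); apply: eq_big_nat => l /andP[_ lN].
  rewrite (orthogonality e1 pe)//; last by rewrite NS ltnS.
  by rewrite -{1}(prednK m0) eqSS; case: eqP => // _; rewrite mulr0.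
rewrite -big_mkcond /= big_nat1_eq /= -ltnS -NS (prednK m0) mN.
have N1 : N%:R != 0 :> C by rewrite pnatr_eq0 -lt0n muln_gt0.
by rewrite (fmorphV (real_complex R)) rmorph_nat mulrCA mulVf// mulr1.
Qed.

End Combine.

(** * Hankel matrices of symbols with small oscillation *)

Section HankelUpperBound.
Variables (R : realType) (n : nat) (e : R[i]).
Hypotheses (n0 : (0 < n)%N) (se : spread_root n e).
Notation C := R[i].
Let N := (2 * n)%N.

Let e1 : nsq e = 1. Proof. by case: se. Qed.
Let pe : N.-primitive_root e. Proof. by case: se. Qed.

(** On the [N]-th roots of unity the frequencies [l + 1] and [- (N - l - 1)] coincide. *)
Lemma symbol_rev gamma x :
  symbol n (conjc e) (fun l => gamma (N - 2 - l)%N) x = symbol n e gamma x.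
Proof.
rewrite /symbol -/N big_nat_rev add0n; apply: eq_big_nat => l /andP[_ lN].
have -> : (N - 2 - (N.-1 - l.+1) = l)%N by lia.
congr (_ * _).
have yk : nsq ((e ^+ x) ^+ (N.-1 - l.+1).+1) = 1 by rewrite !nsqX e1 !expr1n.
rewrite -!conjcX -(invc_nsq1 yk).
have y0 : (e ^+ x) ^+ (N.-1 - l.+1).+1 != 0 by rewrite -nsq_eq0 yk oner_eq0.
apply: (mulIf y0); rewrite mulVf// -exprD.
have -> : (l.+1 + (N.-1 - l.+1).+1 = N)%N by lia.
by rewrite exprAC (prim_expr_order pe) expr1n.
Qed.

Definition osc_le (B : R) (phi : nat -> C) := forall l r, (l < r)%N -> (r - l <= N)%N ->
  \sum_(l <= i < r) normc (phi i - cavg phi l r) <= B * (r - l)%:R.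

Lemma normc_Re_le (z : C) : `|complex.Re z| <= normc z.
Proof.
case: z => a b /=; rewrite -sqrtr_sqr ler_sqrt ?lerDl ?sqr_ge0//.
by rewrite addr_ge0 ?sqr_ge0.
Qed.

Lemma normc_Im_le (z : C) : `|complex.Im z| <= normc z.
Proof.
case: z => a b /=; rewrite -sqrtr_sqr ler_sqrt ?lerDr ?sqr_ge0//.
by rewrite addr_ge0 ?sqr_ge0.
Qed.

(** [upper_form_le] is applied twice: with [conjc e] it gives the entries the weight
    [1 - (j + k + 1) / N], and with [e] and both vectors reversed the weight [(j + k + 1) / N]. The
    two forms add up to the full one. *)
Lemma hankel_bounded_of_osc gamma : osc_le (30 * 40)^-1 (symbol n e gamma) ->
  hankel_bounded n 16 gamma.
Proof.
move=> osc f; set phi := symbol n e gamma in osc.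
have re_osc l r : (l < r)%N -> (r - l <= N)%N ->
    \sum_(l <= i < r) `|complex.Re (phi i) - avg (fun i => complex.Re (phi i)) l r|
    <= (30 * 40)^-1 * (r - l)%:R.
  move=> lr rN; apply: le_trans (osc l r lr rN); apply: ler_sum => i _.
  by rewrite -Re_cavg -ReB normc_Re_le.
have im_osc l r : (l < r)%N -> (r - l <= N)%N ->
    \sum_(l <= i < r) `|complex.Im (phi i) - avg (fun i => complex.Im (phi i)) l r|
    <= (30 * 40)^-1 * (r - l)%:R.
  move=> lr rN; apply: le_trans (osc l r lr rN); apply: ler_sum => i _.
  by rewrite -Im_cavg -ImN -ImD normc_Im_le.
have per : forall i, phi (i + N)%N = phi i by move=> i; exact: symbol_periodic se _.
pose H j := \sum_(0 <= i < n) gamma (j + i)%N * f i.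
(* With this test vector the form equals [|H| ^ 2 / 4] and the two bounds add up to
   [2 |f| ^ 2 + |H| ^ 2 / 8], whence the constant 16. *)
pose g j := (4^-1)%:C * conjc (H j).
have t1 := upper_form_le n0 (spread_rootJ se) per re_osc im_osc f g.
have t2 := upper_form_le n0 se per re_osc im_osc
  (fun i => f (n - i.+1)%N) (fun j => g (n - j.+1)%N).
have rev_sum (V : nmodType) (F : nat -> V) :
    \sum_(0 <= i < n) F (n - i.+1)%N = \sum_(0 <= i < n) F i.
  by rewrite [RHS]big_nat_rev add0n.
rewrite (rev_sum _ (fun i => nsq (f i))) (rev_sum _ (fun i => nsq (g i))) in t2.
have NR : N%:R != 0 :> R by rewrite pnatr_eq0 -lt0n muln_gt0.
have s2 : \sum_(0 <= j < n) \sum_(0 <= i < n) f (n - i.+1)%N * g (n - j.+1)%N *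
    ((1 - (j + i).+1%:R / (2 * n)%:R)%:C * dft n e phi (j + i).+1) =
  \sum_(0 <= j < n) \sum_(0 <= i < n) f i * g j *
    (((j + i).+1%:R / (2 * n)%:R)%:C * gamma (j + i)%N).
  rewrite [RHS]big_nat_rev add0n; apply: eq_big_nat => j /andP[_ jn].
  rewrite [RHS]big_nat_rev add0n; apply: eq_big_nat => i /andP[_ ni].
  congr (_ * (_%:C * _)).
    have -> : (n - j.+1 + (n - i.+1)).+1%:R = (2 * n)%:R - (j + i).+1%:R :> R.
      by rewrite -natrB; [congr _%:R; lia | lia].
    by rewrite mulrBl divff.
  rewrite -[X in dft n X]conjcK.
  have -> : phi = symbol n (conjc e) (fun l => gamma (N - 2 - l)%N).
    by apply/funext => x; rewrite symbol_rev.
  rewrite (dft_symbol _ n0 (spread_rootJ se))//; last by lia.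
  by congr gamma; rewrite /N; lia.
have s1 : \sum_(0 <= j < n) \sum_(0 <= i < n) f i * g j *
    ((1 - (j + i).+1%:R / (2 * n)%:R)%:C * dft n (conjc e) phi (j + i).+1) =
  \sum_(0 <= j < n) \sum_(0 <= i < n) f i * g j *
    ((1 - (j + i).+1%:R / (2 * n)%:R)%:C * gamma (j + i)%N).
  apply: eq_big_nat => j /andP[_ jn]; apply: eq_big_nat => i /andP[_ ni].
  by rewrite (dft_symbol _ n0 se)//; lia.
rewrite s1 in t1; rewrite s2 in t2.
have s12 : \sum_(0 <= j < n) \sum_(0 <= i < n) f i * g j *
      ((1 - (j + i).+1%:R / (2 * n)%:R)%:C * gamma (j + i)%N) +
    \sum_(0 <= j < n) \sum_(0 <= i < n) f i * g j *
      (((j + i).+1%:R / (2 * n)%:R)%:C * gamma (j + i)%N) =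
    (4^-1 * \sum_(0 <= j < n) nsq (H j))%:C.
  rewrite -big_split rcM rc_sum mulr_sumr; apply: eq_bigr => j _.
  rewrite -big_split -mulcJ /= [H j * _]mulrC mulrA -/(g j) /H mulr_sumr.
  by apply: eq_bigr => i _; rewrite rcB; ring.
have gn : \sum_(0 <= j < n) nsq (g j) = 16^-1 * \sum_(0 <= j < n) nsq (H j).
  rewrite mulr_sumr; apply: eq_bigr => j _; rewrite nsqM nsqJ nsq_real.
  by congr (_ * _); field.
have := lerD t1 t2; rewrite -ReD s12 gn /=.
by lra.
Qed.

End HankelUpperBound.

(** * Arcs of the circle and blocks of roots of unity *)

Section DiscreteIntegral.
Context (d : measure_display) (T : measurableType d) (R : realType).
Variables (mu : {measure set T -> \bar R}) (N : nat) (w : {nonneg R}) (pt : nat -> T).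
Hypothesis mset1 : forall x : T, measurable [set x].
Hypothesis pt_inj : {in [pred k | (k < N)%N] &, injective pt}.
Hypothesis muE : forall A, mu A = (w%:num * \sum_(0 <= k < N) (pt k \in A)%:R)%:E.

Lemma integral_discrete_nnsfun (h : {nnsfun T >-> R}) :
  (\int[mu]_x (h x)%:E = (w%:num * \sum_(0 <= k < N) h (pt k))%:E)%E.
Proof.
rewrite (eq_measure_integral (mscale w (msum (fun k => \d_(pt k)) N))); last first.
  move=> A mA _; rewrite muE /mscale/= /msum EFinM big_mkord -sumEFin; congr (_ * _)%E.
have h0 x : setT x -> (0 <= (h x)%:E)%E by move=> _; rewrite lee_fin.
rewrite ge0_integral_mscale//; last exact/measurable_EFinP.
rewrite ge0_integral_measure_sum//; last exact/measurable_EFinP.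
rewrite EFinM big_mkord -sumEFin; congr (_ * _)%E; apply: eq_bigr => i _.
rewrite integral_dirac//; first by rewrite diracE in_setT mul1e.
exact/measurable_EFinP.
Qed.

(** For arbitrary [D] and [g] the integral is computed as a supremum over simple functions: those
    below the integrand are evaluated at the atoms, and a combination of indicators of the atoms
    attains the value. *)
Lemma integral_discrete (D : set T) (g : T -> R) : (forall x, 0 <= g x) ->
  (\int[mu]_(x in D) (g x)%:E =
    (w%:num * \sum_(0 <= k < N) (pt k \in D)%:R * g (pt k))%:E)%E.
Proof.
move=> g0; rewrite integral_mkcond.
set G := (EFin \o g) \_ D.
have GE x : G x = ((x \in D)%:R * g x)%:E.
  by rewrite /G /patch; case: ifP => _; rewrite ?mul1r ?mul0r.
have G0 x : (0 <= G x)%E by rewrite GE lee_fin mulr_ge0.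
apply/eqP; rewrite eq_le; apply/andP; split.
  rewrite ge0_integralTE//; apply: ge_ereal_sup => _ [h /= hG <-].
  rewrite -integralT_nnsfun integral_discrete_nnsfun lee_fin ler_wpM2l//.
  by apply: ler_sum => k _; rewrite -lee_fin -GE hG.
pose s (k : nat) : {nnsfun T >-> R} :=
  if pt k \in D then scale_nnsfun (indic_nnsfun R (mset1 (pt k))) (g0 (pt k)) else nnsfun0.
pose h := sum_nnsfun s N.
have hE x : h x = \sum_(0 <= k < N) (pt k \in D)%:R * g (pt k) * (x == pt k)%:R.
  rewrite /h sum_nnsfunE big_mkord; apply: eq_bigr => k _.
  rewrite /s; case: ifP => _; last by rewrite !mul0r.
  rewrite mul1r /=. by rewrite mindicE in_set1 /= mulrC.
have hpt k : (k < N)%N -> h (pt k) = (pt k \in D)%:R * g (pt k).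
  move=> kN; rewrite hE (bigD1_seq k) ?mem_index_iota ?iota_uniq//= eqxx mulr1.
  rewrite big1_seq ?addr0// => j /andP[jk]; rewrite mem_index_iota => /andP[_ jN].
  have /negPf-> : pt k != pt j.
    by apply: contra jk => /eqP /pt_inj-> //; rewrite inE.
  by rewrite mulr0.
have hG x : ((h x)%:E <= G x)%E.
  have [[k kN ->]|no] := pselect (exists2 k, (k < N)%N & x = pt k).
    by rewrite hpt// GE.
  rewrite hE big1_seq; first exact: G0.
  move=> k /andP[_]; rewrite mem_index_iota => /andP[_ kN].
  by have [xk|_] := eqVneq x (pt k); [case: no; exists k | rewrite mulr0].
apply: (@le_trans _ _ (\int[mu]_x (h x)%:E)%E).
  rewrite integral_discrete_nnsfun lee_fin ler_wpM2l// ler_sum_nat// => k /andP[_ kN].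
  by rewrite hpt.
rewrite integralT_nnsfun ge0_integralTE//; apply: ereal_sup_ubound.
by exists h.
Qed.

Lemma Rintegral_discrete (D : set T) (g : T -> R) :
  Rintegral mu D g = w%:num * \sum_(0 <= k < N) (pt k \in D)%:R * g (pt k).
Proof.
rewrite /Rintegral integralE.
have pE : (EFin \o g)^\+%E = EFin \o (fun x => Num.max (g x) 0).
  by apply/funext => x; rewrite funeposE /= EFin_max.
have nE : (EFin \o g)^\-%E = EFin \o (fun x => Num.max (- g x) 0).
  by apply/funext => x; rewrite funenegE /= EFin_max.
rewrite pE nE /=.
rewrite !integral_discrete; try by move=> x; rewrite le_max lexx orbT.
rewrite -EFinB /= -mulrBr -sumrB; congr (_ * _); apply: eq_bigr => k _.
rewrite -mulrBr; congr (_ * _).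
by case: (leP (g (pt k)) 0) => h1; case: (leP (- g (pt k)) 0) => h2; lra.
Qed.

End DiscreteIntegral.

Section RootsOnCircle.
Variable R : realType.
Notation C := R[i].

Lemma measurable_circle1 (x : circle R) : measurable [set x].
Proof.
rewrite -(setCK [set x]); apply: measurableC; apply: sub_sigma_algebra.
apply: closed_openC.
have -> : [set x] = \val @^-1` [set (\val x : R[i]^o)].
  by apply/seteqP; split=> y /= => [->//|/val_inj].
apply: preimage_closed; last first.
  by apply: accessible_closed_set1; apply: hausdorff_accessible; exact: norm_hausdorff.
move=> y _; exact: initial_continuous.
Qed.

Variable N : nat.
Hypothesis N0 : (0 < N)%N.

Definition xi (k : nat) : circle R := expi (pi *+ 2 / N%:R *+ k).

Lemma val_xi k : \val (xi k) = rootc R N ^+ k.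
Proof. by rewrite rootcX. Qed.

Lemma xi_periodic k : xi (k + N)%N = xi k.
Proof.
apply: val_inj; rewrite !val_xi exprD (prim_expr_order (rootc_prim R N0)).
by rewrite mulr1.
Qed.

Lemma xi_inj : {in [pred k | (k < N)%N] &, injective xi}.
Proof.
move=> j k /[!inE] jN kN /(congr1 \val); rewrite !val_xi => /eqP.
rewrite (eq_prim_root_expr (rootc_prim R N0)) !modn_small// => /eqP.
by [].
Qed.

Lemma unity_roots_xi : @unity_roots R N = xi @` `I_N.
Proof.
apply/seteqP; split=> [z zN|_ [k _ <-]].
  have [k zk] := prim_rootP (rootc_prim R N0) zN.
  by exists k => //=; apply: val_inj; rewrite val_xi.
by rewrite /unity_roots /mkset val_xi exprAC (prim_expr_order (rootc_prim R N0)) expr1n.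
Qed.

Let w : {nonneg R} := NngNum (ltac:(by rewrite invr_ge0) : 0 <= N%:R^-1 :> R).

Lemma haarE (A : set (circle R)) :
  haar_unity_roots N A = (w%:num * \sum_(0 <= k < N) (xi k \in A)%:R)%:E.
Proof.
rewrite /haar_unity_roots unity_roots_xi fsbig_image; last first.
  by move=> j k /set_mem jN /set_mem kN; exact: xi_inj.
by rewrite -fsbig_ord EFinM big_mkord -sumEFin; congr (_ * _)%E.
Qed.

(** The indices run over one full turn starting at [a], so that a block may pass through 1 without
    reduction modulo [N]. *)
Definition root_block (D : set (circle R)) (a M : nat) :=
  [/\ (0 < M)%N, (M <= N)%N &
    forall x, (a <= x < a + N)%N -> (xi x \in D) = (x < a + M)%N].

Lemma sum_root_block (V : pzRingType) D a M (F : nat -> V) : root_block D a M ->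
  (forall k, F (k + N)%N = F k) ->
  \sum_(0 <= k < N) (xi k \in D)%:R * F k = \sum_(a <= x < a + M) F x.
Proof.
move=> [M0 MN DM] FN; rewrite -(@sum_periodic _ _ _ a); last first.
  by move=> k; rewrite FN xi_periodic.
rewrite (big_cat_nat (n := (a + M)%N))//= ?leq_addr ?leq_add2l//.
rewrite [X in _ + X]big1_seq ?addr0; last first.
  move=> x /andP[_]; rewrite mem_index_iota => /andP[ax xN].
  have ax' : (a <= x < a + N)%N by rewrite xN (leq_trans _ ax)// leq_addr.
  by rewrite (DM _ ax') ltnNge ax mul0r.
apply: eq_big_nat => x /andP[ax xM].
have xN : (a <= x < a + N)%N by rewrite ax (leq_trans xM) ?leq_add2l.
by rewrite (DM _ xN) xM mul1r.
Qed.

Lemma haar_root_block D a M : root_block D a M ->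
  haar_unity_roots N D = (M%:R / N%:R)%:E.
Proof.
move=> DM; rewrite haarE /= mulrC; congr (_ / _)%:E.
have := sum_root_block (F := fun=> (1 : R)) DM (fun=> erefl).
rewrite sumr_const_nat addKn => <-.
by apply: eq_bigr => k _; rewrite mulr1.
Qed.

Lemma mean_oscillation_root_block D a M (b : circle R -> C) : root_block D a M ->
  mean_oscillation (@haar_unity_roots R N) D b =
  (M%:R^-1 * \sum_(a <= x < a + M)
    normc (b (xi x) - cavg (b \o xi) a (a + M)))%:E.
Proof.
move=> DM; have [M0 MN _] := DM.
have NR : N%:R != 0 :> R by rewrite pnatr_eq0 -lt0n.
have MR : M%:R != 0 :> R by rewrite pnatr_eq0 -lt0n.
have hD : (@haar_unity_roots R N : {finite_measure set (circle R) -> \bar R}) D =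
  (M%:R / N%:R)%:E := haar_root_block DM.
have avgE : average (@haar_unity_roots R N) D b = cavg (b \o xi) a (a + M).
  rewrite /average /cavg hD addKn.
  rewrite !(Rintegral_discrete measurable_circle1 xi_inj haarE).
  rewrite !(sum_root_block DM); try by move=> k; rewrite xi_periodic.
  rewrite -Re_sum -Im_sum /=; set s := \sum_(a <= i < a + M) _.
  apply/eqP; rewrite eq_complex; apply/andP; split; apply/eqP; rewrite /= ?ReZ ?ImZ;
    by field; rewrite NR MR.
rewrite /mean_oscillation avgE hD.
rewrite (integral_discrete measurable_circle1 xi_inj haarE D
  (g := fun z => normc (b z - cavg (b \o xi) a (a + M)))); last first.
  by move=> z; exact: normc_ge0.
rewrite -EFinM (sum_root_block DM); last by move=> k; rewrite xi_periodic.
by congr EFin => /=; field; rewrite NR MR.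
Qed.

End RootsOnCircle.

Lemma block_index_left (k N p q x : nat) : (p <= N)%N ->
  (x < k + N - p + minn N (p + q).+1)%N -> (x - (k + N) <= q)%N.
Proof. lia. Qed.

Lemma block_index_right (k N p x : nat) : (k + N - p <= x)%N -> (k + N - x <= p)%N.
Proof. lia. Qed.

Lemma block_index_out (k N p q x : nat) : (p <= N)%N ->
  (x < k + N - p + N)%N -> (k + N - p + minn N (p + q).+1 <= x)%N ->
  [/\ (p < N)%N, (q < N)%N, (k + N + q.+1 <= x)%N & (x + p.+1 <= k + N + N)%N].
Proof. by move=> *; split; lia. Qed.

Section ArcsAndBlocks.
Variables (R : realType) (N : nat).
Hypothesis N0 : (0 < N)%N.

Let step : R := pi *+ 2 / N%:R.
Let NR : 0 < N%:R :> R. Proof. by rewrite ltr0n. Qed.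
Let step0 : 0 < step.
Proof. by rewrite divr_gt0// pmulrn_lgt0// pi_gt0. Qed.

Lemma expi_step (s t : R) : s < t < s + N%:R -> expi (step * s) != expi (step * t).
Proof.
move=> /andP[st tN]; apply/negP => /eqP /(congr1 \val) /= e.
have : expc (step * (t - s)) != 1.
  apply: expc_neq1; first by rewrite mulr_gt0// subr_gt0.
  have : step * (t - s) < step * N%:R by rewrite ltr_pM2l// ltrBlDl.
  by rewrite /step divfK// gt_eqF.
have -> : expc (step * (t - s)) = expc (step * t) * conjc (expc (step * s)).
  rewrite -[conjc _](invc_nsq1 (nsq_expc _)).
  have s0 : expc (step * s) != 0 by rewrite -nsq_eq0 nsq_expc oner_eq0.
  by apply: (mulIf s0); rewrite divfK// -expcD -mulrDr subrK.
have -> : expc (step * t) = expc (step * s) by rewrite /expc e.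
by rewrite mulcJ nsq_expc eqxx.
Qed.

Lemma expi_xi k : xi R N k = expi (step * k%:R).
Proof. by rewrite /xi -/step mulr_natr. Qed.

Lemma root_block_arc l r : (l < r)%N -> (r - l <= N)%N ->
  exists2 D : set (circle R), is_arc D & root_block N D l (r - l).
Proof.
move=> lr rN.
exists (@expi R @` [set` `[step * l%:R, step * (r%:R - 1)]]); first by eexists.
split; [by rewrite subn_gt0 | by [] |] => x /andP[lx xN].
rewrite subnKC ?(ltnW lr)//; have [xr|xr] := ltnP x r.
  apply/mem_set; exists (step * x%:R); last by rewrite expi_xi.
  rewrite /= in_itv /= !ler_pM2l// ler_nat lx /= lerBrDr natr1 ler_nat.
  exact: xr.
apply/negP => /set_mem [t /=]; rewrite in_itv /= => /andP[t1 t2] e.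
have tE : t = step * (t / step) by rewrite mulrC divfK// gt_eqF.
rewrite tE ler_pM2l// in t1; rewrite tE ler_pM2l// in t2.
have := @expi_step (t / step) x%:R; rewrite -tE e expi_xi eqxx => /(_ _)/negP; apply=> //.
have h1 : r%:R <= x%:R :> R by rewrite ler_nat.
have h2 : x%:R < l%:R + N%:R :> R by rewrite -natrD ltr_nat.
by apply/andP; split; lra.
Qed.

(** From a root in the arc one walks [q] steps up and [p] steps down until the angle leaves [I]. The
    minimum with [N] covers arcs that contain all the roots, and the shift by [N] keeps the starting
    index natural. *)
Lemma arc_root_block (D : set (circle R)) k : is_arc D -> D (xi R N k) ->
  exists a M, root_block N D a M.
Proof.
move=> [I ->{D}] [t0 /= It0 e0].
pose y0 := t0 / step - k%:R.
pose ang (x : R) := step * (y0 + x).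
have ang0 : ang k%:R = t0 by rewrite /ang /y0 subrK mulrC divfK// gt_eqF.
have conv (s t u : R) : ang s \in I -> ang u \in I -> s <= t <= u -> ang t \in I.
  move=> Is Iu /andP[st tu].
  apply: (@interval_is_interval _ I _ _ Is Iu); rewrite /ang !ler_pM2l// !lerD2l.
  by rewrite st tu.
have angE (x : nat) : expi (ang (x%:R - N%:R)) = xi R N x.
  apply: val_inj; rewrite expi_xi /=; change (expc (ang (x%:R - N%:R)) = expc (step * x%:R)).
  have tk : expc t0 = expc (step * k%:R).
    by have := congr1 \val e0; rewrite expi_xi.
  have s0 : expc (step * k%:R) != 0 by rewrite -nsq_eq0 nsq_expc oner_eq0.
  have pN1 : expc (step * N%:R) = 1 by rewrite /step divfK ?gt_eqF// expc2pi.
  apply: (mulIf s0).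
  transitivity (expc (ang (x%:R - N%:R) + step * N%:R + step * k%:R)).
    by rewrite !expcD pN1 mulr1.
  rewrite -[in RHS]tk -expcD; congr expc; rewrite -ang0 /ang; ring.
pose up i := ang (k%:R + i%:R) \in I; pose dn i := ang (k%:R - i%:R) \in I.
(* [find] returns [N] when the walk does not leave [I] within a full turn. *)
pose q := find (fun i => ~~ up i.+1) (iota 0 N).
pose p := find (fun i => ~~ dn i.+1) (iota 0 N).
have qN : (q <= N)%N by rewrite -[leqRHS](size_iota 0) find_size.
have pN : (p <= N)%N by rewrite -[leqRHS](size_iota 0) find_size.
have upP i : (i <= q)%N -> up i.
  case: i => [|i] iq; first by rewrite /up addr0 ang0.
  have := before_find 0%N (iq : (i < q)%N); rewrite nth_iota ?(leq_trans iq)// add0n.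
  by move=> /negbFE.
have dnP i : (i <= p)%N -> dn i.
  case: i => [|i] ip; first by rewrite /dn subr0 ang0.
  have := before_find 0%N (ip : (i < p)%N); rewrite nth_iota ?(leq_trans ip)// add0n.
  by move=> /negbFE.
have upN : (q < N)%N -> ~~ up q.+1.
  move=> h; have /(nth_find 0%N) : has (fun i => ~~ up i.+1) (iota 0 N).
    by rewrite has_find size_iota.
  by rewrite nth_iota.
have dnN : (p < N)%N -> ~~ dn p.+1.
  move=> h; have /(nth_find 0%N) : has (fun i => ~~ dn i.+1) (iota 0 N).
    by rewrite has_find size_iota.
  by rewrite nth_iota.
exists (k + N - p)%N, (minn N (p + q).+1).
split; [by rewrite leq_min N0 | by rewrite geq_minl |].
move=> x /andP[ax xa].
have [xM|xM] := ltnP.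
  apply/mem_set; exists (ang (x%:R - N%:R)); last exact: angE.
  have [kx|kx] := leqP (k + N) x.
    have := upP (x - (k + N))%N; rewrite /up natrB// natrD.
    rewrite (_ : k%:R + (x%:R - (k%:R + N%:R)) = x%:R - N%:R :> R); last by ring.
    by apply; exact: block_index_left pN xM.
  have := dnP (k + N - x)%N; rewrite /dn natrB ?(ltnW kx)// natrD.
  rewrite (_ : k%:R - (k%:R + N%:R - x%:R) = x%:R - N%:R :> R); last by ring.
  by apply; exact: block_index_right.
have [pN' qN' x1 x2] := block_index_out pN xa xM.
apply/negP => /set_mem [t It et].
pose y := t / step - y0.
have tE : ang y = t by rewrite /ang /y addrC subrK mulrC divfK// gt_eqF.
have Ik : ang k%:R \in I by rewrite ang0.
have Iy : ang y \in I by rewrite tE.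
move: x1 x2; rewrite -!(ler_nat R) !natrD => x1 x2.
(* If the lift [y] of the point lay beyond either exit, convexity of [I] would put the exit in [I].
   Otherwise [y < x - N < y + N], and [expi_step] separates the two points. *)
have [y1|y1] := leP (k%:R + q.+1%:R) y.
  have := upN qN'; rewrite /up.
  by rewrite (conv k%:R _ y)// y1 lerDl ler0n.
have [y2|y2] := leP y (k%:R - p.+1%:R).
  have := dnN pN'; rewrite /dn.
  by rewrite (conv y _ k%:R)// y2 gerBl ler0n.
have := @expi_step (y0 + y) (y0 + (x%:R - N%:R)).
rewrite -/(ang y) -/(ang _) angE tE et eqxx => /(_ _)/negP; apply=> //.
by apply/andP; split; lra.
Qed.

End ArcsAndBlocks.

(** * The theorem *)

Section OperatorNorm.
Variables (R : realType) (n : nat) (gamma : nat -> R[i]).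
Notation C := R[i].

Lemma euclidean_normE (x : 'cV[C]_n) : euclidean_norm x = Num.sqrt (\sum_i nsq (x i 0)).
Proof. by congr Num.sqrt; apply: eq_bigr => i _; rewrite nsq_normc. Qed.

Lemma euclidean_norm_col (v : nat -> C) :
  euclidean_norm (\col_(i < n) v i) = Num.sqrt (\sum_(0 <= i < n) nsq (v i)).
Proof.
rewrite euclidean_normE big_mkord; congr Num.sqrt.
by apply: eq_bigr => i _; rewrite mxE.
Qed.

Lemma hankel_mx_col (v : nat -> C) :
  hankel_mx n gamma *m (\col_(i < n) v i) =
  \col_(j < n) \sum_(0 <= k < n) gamma (j + k)%N * v k.
Proof.
apply/matrixP => j i; rewrite !mxE big_mkord.
by apply: eq_bigr => k _; rewrite !mxE.
Qed.

Lemma operator_norm_le (A : R) : 0 <= A -> hankel_bounded n (A ^+ 2) gamma ->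
  (operator_norm (hankel_mx n gamma) <= A%:E)%E.
Proof.
move=> A0 hG; apply: ge_ereal_sup => _ [x /= x1 <-]; rewrite lee_fin.
have [v xv] : exists v : nat -> C, x = \col_(i < n) v i.
  exists (fun k => if insub k is Some i then x i 0 else 0).
  by apply/matrixP => i j; rewrite mxE valK ord1.
rewrite xv (euclidean_norm_col v) in x1.
rewrite xv hankel_mx_col (euclidean_norm_col (fun j => \sum_(0 <= k < n) gamma (j + k)%N * v k)).
have s0 : 0 <= \sum_(0 <= i < n) nsq (v i) by apply: sumr_ge0 => i _; exact: nsq_ge0.
have s1 : \sum_(0 <= i < n) nsq (v i) <= 1.
  by rewrite -(sqr_sqrtr s0) expr_le1// sqrtr_ge0.
rewrite -(ger0_norm A0) -sqrtr_sqr ler_sqrt ?sqr_ge0//.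
apply: le_trans (hG v) _.
by rewrite ler_piMr ?sqr_ge0.
Qed.

Lemma hankel_bounded_of_norm (A : R) : 0 <= A ->
  (operator_norm (hankel_mx n gamma) <= A%:E)%E -> hankel_bounded n (A ^+ 2) gamma.
Proof.
move=> A0 hA v; set s := \sum_(0 <= k < n) nsq (v k).
have s0 : 0 <= s by apply: sumr_ge0 => i _; exact: nsq_ge0.
have [sz|sn] := eqVneq s 0.
  have v0 k : (k < n)%N -> v k = 0.
    move=> kn; apply/eqP; rewrite -nsq_eq0 eq_le nsq_ge0 andbT -sz /s.
    rewrite (bigD1_seq k) ?mem_index_iota ?iota_uniq//= lerDl.
    by apply: sumr_ge0 => i _; exact: nsq_ge0.
  rewrite sz mulr0 big1_seq// => j _; rewrite big1_seq ?nsq0// => k /andP[_].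
  by rewrite mem_index_iota => /andP[_ kn]; rewrite v0// mulr0.
have sp : 0 < s by rewrite lt_neqAle eq_sym sn.
pose t := Num.sqrt s; have tp : 0 < t by rewrite sqrtr_gt0.
have t2 : t ^+ 2 = s by rewrite sqr_sqrtr.
pose u k := (t^-1)%:C * v k.
have u1 : \sum_(0 <= k < n) nsq (u k) = 1.
  under eq_bigr do rewrite nsqM nsq_real.
  by rewrite -mulr_sumr -/s -t2 -exprMn mulVf ?gt_eqF// expr1n.
have : ((euclidean_norm (hankel_mx n gamma *m \col_(i < n) u i))%:E <= A%:E)%E.
  apply: le_trans hA; apply: ereal_sup_ubound; exists (\col_(i < n) u i) => //=.
  by rewrite (euclidean_norm_col u) u1 sqrtr1.
rewrite lee_fin hankel_mx_col (euclidean_norm_col (fun j => \sum_(0 <= k < n) gamma (j + k)%N * u k)).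
set S := \sum_(0 <= j < n) _.
have S0 : 0 <= S by apply: sumr_ge0 => i _; exact: nsq_ge0.
move=> hS; have SA : S <= A ^+ 2.
  by rewrite -(sqr_sqrtr S0) ler_pXn2r ?nnegrE ?sqrtr_ge0.
rewrite (_ : \sum_(0 <= j < n) _ = s * S); first by rewrite mulrC ler_wpM2r.
rewrite /S -t2 mulr_sumr; apply: eq_bigr => j _.
rewrite -nsq_real -nsqM mulr_sumr; congr nsq; apply: eq_bigr => k _.
have tt : t%:C * (t^-1)%:C = 1 :> C by rewrite -rcM divff ?gt_eqF.
by rewrite /u mulrCA [t%:C * _]mulrA tt mul1r.
Qed.

(** By homogeneity, [gamma] is scaled so that its oscillation becomes [(30 * 40)^-1]; the bound 16
    turns into the factor 4. *)
Lemma hankel_bounded_osc (e : C) (B : R) : (0 < n)%N -> spread_root n e -> 0 < B ->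
  osc_le n B (symbol n e gamma) -> hankel_bounded n ((4 * (30 * 40) * B) ^+ 2) gamma.
Proof.
move=> n0 se B0 osc; pose s : R := (30 * 40 * B)^-1.
have sp : 0 < s by rewrite invr_gt0 !mulr_gt0.
pose g l := s%:C * gamma l.
have symE x : symbol n e g x = s%:C * symbol n e gamma x.
  by rewrite /symbol mulr_sumr; apply: eq_bigr => l _; rewrite mulrA.
have avgE l r : cavg (symbol n e g) l r = s%:C * cavg (symbol n e gamma) l r.
  rewrite /cavg (_ : \sum_(l <= i < r) symbol n e g i = s%:C * \sum_(l <= i < r) symbol n e gamma i).
    by rewrite mulrCA.
  by rewrite mulr_sumr; apply: eq_bigr => i _; exact: symE.
have og : osc_le n (30 * 40)^-1 (symbol n e g).
  move=> l r lr rN; have := ler_wpM2l (ltW sp) (osc l r lr rN).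
  rewrite mulr_sumr; have -> : s * (B * (r - l)%:R) = (30 * 40)^-1 * (r - l)%:R.
    by rewrite /s; field; rewrite gt_eqF.
  apply: le_trans; apply: ler_sum => i _; rewrite symE avgE -mulrBr normcM.
  by rewrite [normc s%:C]/= expr0n addr0 sqrtr_sqr gtr0_norm.
move=> v; have := hankel_bounded_of_osc n0 se og v.
have -> : \sum_(0 <= j < n) nsq (\sum_(0 <= k < n) g (j + k)%N * v k) =
    s ^+ 2 * \sum_(0 <= j < n) nsq (\sum_(0 <= k < n) gamma (j + k)%N * v k).
  rewrite mulr_sumr; apply: eq_bigr => j _; rewrite -nsq_real -nsqM mulr_sumr.
  by congr nsq; apply: eq_bigr => k _; rewrite mulrA.
set X := \sum_(0 <= j < n) nsq (\sum_(0 <= k < n) gamma (j + k)%N * v k).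
set Y := \sum_(0 <= k < n) nsq (v k).
move=> /(ler_wpM2l (sqr_ge0 (30 * 40 * B))).
have -> : (30 * 40 * B) ^+ 2 * (s ^+ 2 * X) = X by rewrite /s; field; rewrite gt_eqF.
have -> : (30 * 40 * B) ^+ 2 * (16 * Y) = (4 * (30 * 40) * B) ^+ 2 * Y by ring.
by [].
Qed.

End OperatorNorm.

Theorem corollary1 (R : realType) :
  exists c1 c2 : R, 0 < c1 /\ 0 < c2 /\
    forall (n : nat) (gamma : nat -> complex R), (1 <= n)%N ->
      (c1%:E * bmo_norm (@haar_unity_roots R (2 * n)) (standard_symbol n gamma)
         <= operator_norm (hankel_mx n gamma))%E /\
      (operator_norm (hankel_mx n gamma)
         <= c2%:E * bmo_norm (@haar_unity_roots R (2 * n))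
                             (standard_symbol n gamma))%E.
Proof.
exists 40^-1, (4 * (30 * 40)); split; first by rewrite invr_gt0.
split; first by rewrite !mulr_gt0.
move=> n gamma n0; pose N := (2 * n)%N; have N0 : (0 < N)%N by rewrite muln_gt0.
(* [standard_symbol] is a polynomial in [conjc z], hence the conjugate generator. *)
pose e := conjc (rootc R N).
have se : spread_root n e by apply: spread_rootJ; exact: spread_rootc.
have symE : standard_symbol n gamma \o xi R N = symbol n e gamma.
  apply/funext => k; rewrite /= /standard_symbol /symbol; apply: eq_bigr => l _.
  by rewrite val_xi conjcX.
have oscE D a M : root_block N D a M ->
    mean_oscillation (@haar_unity_roots R N) D (standard_symbol n gamma) =
    (M%:R^-1 * \sum_(a <= x < a + M)
      normc (symbol n e gamma x - cavg (symbol n e gamma) a (a + M)))%:E.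
  by move=> DM; rewrite (mean_oscillation_root_block N0 _ DM) symE -symE.
set bmo := bmo_norm _ _; set op := operator_norm _.
have op0 : (0 <= op)%E.
  apply: ereal_sup_ubound; exists 0 => /=.
    by rewrite euclidean_normE big1 ?sqrtr0// => i _; rewrite mxE nsq0.
  by rewrite mulmx0 euclidean_normE big1 ?sqrtr0// => i _; rewrite mxE nsq0.
have bmo_ge l r : (l < r)%N -> (r - l <= N)%N ->
    (((r - l)%:R^-1 * \sum_(l <= x < r)
      normc (symbol n e gamma x - cavg (symbol n e gamma) l r))%:E <= bmo)%E.
  move=> lr rN; have [D arcD DM] := root_block_arc R N0 lr rN.
  apply: ereal_sup_ubound; exists D; last by rewrite (oscE _ _ _ DM) subnKC// ltnW.
  split=> //; rewrite [X in X != _](haar_root_block N0 DM) eqe mulf_neq0 ?invr_eq0 ?pnatr_eq0 -?lt0n//.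
  by rewrite subn_gt0.
split.
  move: op0; rewrite /op; case E : (operator_norm _) => [A| |] // A0; last by rewrite leey.
  rewrite lee_fin in A0.
  have hG : hankel_bounded n (A ^+ 2) gamma by apply: hankel_bounded_of_norm => //; rewrite E.
  have : (bmo <= (40 * A)%:E)%E.
    apply: ge_ereal_sup => _ [D [arcD muD] <-].
    have [k xiD] : exists k, D (xi R N k).
      apply: contrapT => no; move/eqP: muD; apply.
      rewrite [LHS](haarE N0) big1 ?mulr0// => k _.
      by rewrite memNset// => Dk; apply: no; exists k.
    have [a [M DM]] := arc_root_block N0 arcD xiD.
    have [M0 MN _] := DM.
    rewrite (oscE _ _ _ DM) lee_fin mulrC ler_pdivrMr ?ltr0n//.
    exact: (symbol_oscillation n0 se a A0 hG M0 MN).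
  move=> h; apply: (@le_trans _ _ ((40^-1)%:E * (40 * A)%:E)%E).
    by rewrite lee_pmul2l// lte_fin invr_gt0.
  by rewrite -EFinM lee_fin mulrA mulVf// mul1r.
(* The value [-oo] is excluded by a block consisting of a single root. *)
case E : bmo => [B| |]; last 2 first.
- by rewrite gt0_muley ?leey// lte_fin !mulr_gt0.
- have := bmo_ge 0%N 1%N (ltn0Sn _) N0; by rewrite E.
have B0 : 0 <= B.
  have := bmo_ge 0%N 1%N (ltn0Sn _) N0; rewrite E lee_fin; apply: le_trans.
  by rewrite mulr_ge0 ?invr_ge0// sumr_ge0// => i _; exact: normc_ge0.
(* [B] may be zero, whereas [hankel_bounded_osc] asks for a positive bound; it is applied to
   [B + t], with [t] chosen so that the excess is exactly [d]. *)
apply/lee_addgt0Pr => d d0.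
pose t := d / (4 * (30 * 40)); have t0 : 0 < t by rewrite divr_gt0// !mulr_gt0.
have Bt : 0 < B + t by rewrite ltr_wpDl.
have osc : osc_le n (B + t) (symbol n e gamma).
  move=> l r lr rN; have rl : 0 < (r - l)%:R :> R by rewrite ltr0n subn_gt0.
  have := bmo_ge l r lr rN; rewrite E lee_fin mulrC ler_pdivrMr// => /le_trans-> //.
  by rewrite ler_pM2r// lerDl ltW.
have K0 : 0 <= 4 * (30 * 40) * (B + t) by rewrite !mulr_ge0// ltW.
apply: le_trans (operator_norm_le K0 (hankel_bounded_osc n0 se Bt osc)) _.
by rewrite -EFinM -EFinD lee_fin mulrDr lerD2l /t mulrC divfK.
Qed.
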